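(* For most closed convex curves $C\in\mathcal{C}$, most points of $\mathbb{R}^2$ see continuum many images of themselves. That is, there is a comeagre set of curves $C\in\mathcal{C}$ such that $C$ has a unique tangent line at each of its points and the set of those $u\in\mathbb{R}^2$ for which $\{z\in C: u \text{ sees an image of itself via } z\}$ has the cardinality of the continuum is comeagre in $\mathbb{R}^2$.
   Context: $\mathcal{C}$ is the set of all closed convex curves in the plane $\mathbb{R}^2$ (boundaries of compact convex sets with non-empty interior), equipped with the Hausdorff metric. ''Most'' is meant in the Baire category sense: a property holds for most elements of a space if it holds for all elements of a comeagre (residual) subset. For most $C\in\mathcal{C}$ the tangent (supporting) line $T(z)$ to $C$ at $z$ is unique at every $z\in C$; then the normal line $N(z)$ to $C$ at $z$ (the line through $z$ orthogonal to $T(z)$) is also unique. A point $u\in\mathbb{R}^2$ sees an image of a point $v\in\mathbb{R}^2$ via $z\in C$ if $u$, $v$ and $C$ lie on the same side of $T(z)$ and the line $N(z)$ halves the angle $\angle uzv$. In particular, $u$ sees an image of itself via $z$ if $u\in N(z)$ and $u$ and $C$ are on the same side of $T(z)$. *)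

(* Defs.v *)
From HB Require Import structures.
From mathcomp Require Import all_boot all_order all_algebra.
From mathcomp Require Import all_classical all_reals all_analysis.
From mathcomp Require Import ring lra.

Set Implicit Arguments.
Unset Strict Implicit.
Unset Printing Implicit Defensive.

Import Order.TTheory GRing.Theory Num.Theory.
Import numFieldNormedType.Exports.

Local Open Scope classical_set_scope.
Local Open Scope ring_scope.

Definition nowhere_dense (T : topologicalType) (A : set T) : Prop :=
  interior (closure A) = set0.

Definition meagre (T : topologicalType) (A : set T) : Prop :=
  exists F : nat -> set T,
    (forall n, nowhere_dense (F n)) /\ A `<=` \bigcup_n F n.

Definition comeagre (T : topologicalType) (A : set T) : Prop := meagre (~` A).

Definition frontier (T : topologicalType) (A : set T) : set T :=
  closure A `\` interior A.

Notation plane R := 'rV[R]_2.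

Definition dot (R : realType) (u v : plane R) : R := \sum_i u 0 i * v 0 i.

(* The library norm of 'rV[R]_2 is the sup norm. *)
Definition enorm (R : realType) (u : plane R) : R := Num.sqrt (dot u u).

Definition edist (R : realType) (u v : plane R) : R := enorm (u - v).

Definition thickening (R : realType) (e : R) (A : set (plane R)) :
  set (plane R) := [set x | exists2 a, A a & edist x a <= e].

(* Meaningful for non-empty bounded sets, the only ones to which it is
   applied: otherwise the set of radii can be empty, and inf set0 = 0. *)
Definition hausdorff_dist (R : realType) (A B : set (plane R)) : R :=
  inf [set e | [/\ 0 <= e, A `<=` thickening e B & B `<=` thickening e A]].

Definition closed_convex_curve (R : realType) (C : set (plane R)) : Prop :=
  exists K : set (plane R),
    [/\ convex_set K, compact K, interior K !=set0 & C = frontier K].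

Record curve (R : realType) := Curve {
  curve_set :> set (plane R);
  curveP : closed_convex_curve curve_set
}.

HB.instance Definition _ (R : realType) := gen_eqMixin (curve R).
HB.instance Definition _ (R : realType) := gen_choiceMixin (curve R).

Section metric.
Context {R : realType}.
Implicit Types (u v x y : plane R) (A B D : set (plane R)) (C : curve R).

Lemma dotE u v : dot u v = u 0 0 * v 0 0 + u 0 1 * v 0 1.
Proof. by rewrite /dot big_ord_recl big_ord1; congr (_ + u 0 _ * v 0 _); exact/val_inj. Qed.

Lemma dotuu_ge0 u : 0 <= dot u u.
Proof. by rewrite dotE addr_ge0// -expr2 sqr_ge0. Qed.

Lemma enorm_ge0 u : 0 <= enorm u.
Proof. exact: sqrtr_ge0. Qed.

Lemma enorm0 : enorm (0 : plane R) = 0.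
Proof. by rewrite /enorm dotE !mxE !mul0r addr0 sqrtr0. Qed.

Lemma enormN u : enorm (- u) = enorm u.
Proof. by rewrite /enorm !dotE !mxE !mulrNN. Qed.

Lemma enormD u v : enorm (u + v) <= enorm u + enorm v.
Proof.
rewrite -(@ler_pXn2r _ 2) ?nnegrE ?addr_ge0 ?enorm_ge0//.
rewrite sqrrD !sqr_sqrtr ?dotuu_ge0// !dotE !mxE.
set a := u 0 0; set b := u 0 1; set c := v 0 0; set d := v 0 1.
have key : a * c + b * d <= enorm u * enorm v.
  rewrite -sqrtrM ?dotuu_ge0// (le_trans (ler_norm _))// -sqrtr_sqr.
  rewrite ler_wsqrtr// !dotE -/a -/b -/c -/d.
  rewrite -subr_ge0 (_ : _ - _ = (a * d - b * c) ^+ 2) ?sqr_ge0//; ring.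
rewrite -mulr_natl; lra.
Qed.

Lemma edistxx x : edist x x = 0.
Proof. by rewrite /edist subrr enorm0. Qed.

Lemma edistC x y : edist x y = edist y x.
Proof. by rewrite /edist -enormN opprB. Qed.

Lemma edist_triangle y x z : edist x z <= edist x y + edist y z.
Proof. by rewrite /edist -[x - z](subrKA y) enormD. Qed.

Lemma coord_le_enorm u (j : 'I_2) : `|u 0 j| <= enorm u.
Proof.
rewrite -sqrtr_sqr ler_wsqrtr// dotE !expr2.
have [->|->] : j = 0 \/ j = 1.
  by case: j => -[|[|//]] ?; [left|right]; exact/val_inj.
- by rewrite lerDl -expr2 sqr_ge0.
- by rewrite lerDr -expr2 sqr_ge0.
Qed.

Lemma enorm_le_norm u : enorm u <= `|u| *+ 2.
Proof.
have h j : `|u 0 j| <= `|u|.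
  rewrite [leRHS]/Num.norm/= mx_normrE.
  by apply/bigmax_geP; right; exists (0, j).
rewrite -(@ler_pXn2r _ 2) ?nnegrE ?enorm_ge0 ?mulrn_wge0//.
rewrite sqr_sqrtr ?dotuu_ge0// dotE -!expr2.
rewrite -[in leLHS](real_normK (num_real (u 0 0))).
rewrite -[in leLHS](real_normK (num_real (u 0 1))).
have := h 0; have := h 1; have := normr_ge0 (u 0 0); have := normr_ge0 (u 0 1).
rewrite -[_ *+ 2]mulr_natl; nra.
Qed.

Lemma closure_thickening A x :
  (forall e, 0 < e -> thickening e A x) -> closure A x.
Proof.
move=> h U /nbhs_ballP[e /= e0 xU].
have [a Aa xa] := h (e / 2) (divr_gt0 e0 (ltr0Sn R 1)).
exists a; split=> //; apply: xU; split=> // i j; rewrite (ord1 i).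
rewrite /ball/=; have := coord_le_enorm (x - a) j; rewrite !mxE => /le_lt_trans.
apply; apply: (le_lt_trans xa); lra.
Qed.

Lemma frontier_nonempty A : compact A -> interior A !=set0 ->
  frontier A !=set0.
Proof.
move=> cA [p /interior_subset Ap].
have [||c /set_mem Ac cmax] := @EVT_max_rV R _ (fun v : plane R => v 0 0) A _ cA.
- by exists p.
- by apply: continuous_subspaceT => v; exact: coord_continuous.
exists c; split; first exact: subset_closure.
move=> /nbhs_ballP[e /= e0 ceA].
have /ceA/mem_set/cmax : ball c e (\row_j (c 0 j + e / 2)).
  split=> // i j; rewrite (ord1 i) !mxE /ball/= opprD addrA subrr sub0r normrN.
  by rewrite gtr0_norm; lra.
by rewrite mxE leNgt ltrDl divr_gt0.
Qed.

Lemma curve_nonempty C : (C : set (plane R)) !=set0.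
Proof. by case: C => _ /= [K [_ cK iK ->]]; exact: frontier_nonempty. Qed.

Lemma curve_closed C : closed (C : set (plane R)).
Proof.
case: C => _ /= [K [_ cK _ ->]]; apply: closedI; first exact: closed_closure.
exact/open_closedC/open_interior.
Qed.

Lemma curve_bounded C : exists M, forall x, curve_set C x -> enorm x <= M.
Proof.
case: C => _ /= [K [_ cK _ ->]].
have [M [_ KM]] := compact_bounded cK.
exists ((M + 1) *+ 2) => x [clx _].
have Kx : K x by exact: (compact_closed (@norm_hausdorff _ _) cK).
apply: (le_trans (enorm_le_norm x)); rewrite lerMn2r/=.
by apply: KM => //; rewrite ltrDl.
Qed.

Let radii A B :=
  [set e | [/\ 0 <= e, A `<=` thickening e B & B `<=` thickening e A]].

Let radii_lbound A B : has_lbound (radii A B).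
Proof. by exists 0 => e []. Qed.

Let radii_has_inf C1 C2 : has_inf (radii C1 C2).
Proof.
split; last exact: radii_lbound.
have [M1 h1] := curve_bounded C1; have [M2 h2] := curve_bounded C2.
have [c1 m1] := curve_nonempty C1; have [c2 m2] := curve_nonempty C2.
have d x y : curve_set C1 x -> curve_set C2 y -> edist x y <= M1 + M2.
  move=> /h1 xM /h2 yM; rewrite /edist (le_trans (enormD _ _))// enormN.
  exact: lerD.
exists (M1 + M2); split.
- exact: le_trans (enorm_ge0 _) (d _ _ m1 m2).
- by move=> x xC; exists c2 => //; exact: d.
- by move=> x xC; exists c1 => //; rewrite edistC; exact: d.
Qed.

Let thickening_le A e1 e2 : e1 <= e2 -> thickening e1 A `<=` thickening e2 A.
Proof. by move=> e12 x [a Aa xa]; exists a => //; exact: le_trans e12. Qed.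

Let thickening_trans A B D e1 e2 :
  A `<=` thickening e1 B -> B `<=` thickening e2 D ->
  A `<=` thickening (e1 + e2) D.
Proof.
move=> AB BD x /AB[b /BD[d Dd bd] xb]; exists d => //.
by rewrite (le_trans (edist_triangle b _ _))// lerD.
Qed.

Lemma hausdorff_distxx C : hausdorff_dist C C = 0.
Proof.
have r0 : radii C C 0.
  by split=> // x Cx; exists x => //; rewrite edistxx.
apply/eqP; rewrite eq_le; apply/andP; split.
- exact: (ge_inf (radii_lbound C C)).
- by apply: lb_le_inf; [exists 0|move=> e []].
Qed.

Lemma hausdorff_distC C1 C2 : hausdorff_dist C1 C2 = hausdorff_dist C2 C1.
Proof. by congr inf; apply/seteqP; split=> e []. Qed.

Lemma hausdorff_dist_triangle C2 C1 C3 :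
  hausdorff_dist C1 C3 <= hausdorff_dist C1 C2 + hausdorff_dist C2 C3.
Proof.
apply/ler_addgt0Pr => e e0; have e20 : 0 < e / 2 by rewrite divr_gt0.
have [a [a0 a1 a2] ha] := inf_adherent e20 (radii_has_inf C1 C2).
have [b [b0 b1 b2] hb] := inf_adherent e20 (radii_has_inf C2 C3).
apply: (@le_trans _ _ (a + b)).
  apply: (ge_inf (radii_lbound C1 C3)); split; first exact: addr_ge0.
  - exact: thickening_trans a1 b1.
  - by rewrite addrC; exact: thickening_trans b2 a2.
by move: ha hb; rewrite -/(hausdorff_dist C1 C2) -/(hausdorff_dist C2 C3); lra.
Qed.

Lemma hausdorff_dist_eq0 C1 C2 : hausdorff_dist C1 C2 = 0 -> C1 = C2.
Proof.
move=> h0.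
have sub : forall e, 0 < e -> radii C1 C2 e.
  move=> e e0; have [a [a0 a1 a2]] := inf_adherent e0 (radii_has_inf C1 C2).
  rewrite -/(hausdorff_dist C1 C2) h0 add0r => /ltW ae.
  split; [exact: ltW|exact: subset_trans (thickening_le ae)|].
  exact: subset_trans (thickening_le ae).
have E : C1 = C2 :> set (plane R).
  apply/seteqP; split=> x xC; apply: curve_closed; apply: closure_thickening.
  - by move=> e /sub[_ + _]; exact.
  - by move=> e /sub[_ _]; exact.
case: C1 C2 E {h0 sub} => [A pA] [B pB] /= AB; rewrite AB in pA *.
by congr Curve; exact: Prop_irrelevance.
Qed.

HB.instance Definition _ := isMetric.Build R (curve R)
  hausdorff_distxx hausdorff_dist_eq0 hausdorff_distC hausdorff_dist_triangle.

End metric.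

(* The line through p orthogonal to n, and its closed side towards n. *)
Definition line (R : realType) (p n : plane R) : set (plane R) :=
  [set x | dot (x - p) n = 0].

Definition half_plane (R : realType) (p n : plane R) : set (plane R) :=
  [set x | 0 <= dot (x - p) n].

Definition is_line (R : realType) (L : set (plane R)) : Prop :=
  exists p n, n != 0 /\ L = line p n.

Definition same_side (R : realType) (L A : set (plane R)) : Prop :=
  exists p n, [/\ n != 0, L = line p n & A `<=` half_plane p n].

Definition tangent_line (R : realType) (C : set (plane R)) (z : plane R)
    (T : set (plane R)) : Prop :=
  [/\ is_line T, T z & same_side T C].

Definition orthogonal_lines (R : realType) (L M : set (plane R)) : Prop :=
  forall x y u v, L x -> L y -> M u -> M v -> dot (x - y) (u - v) = 0.

Definition normal_line (R : realType) (T : set (plane R)) (z : plane R)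
    (N : set (plane R)) : Prop :=
  [/\ is_line N, N z & orthogonal_lines T N].

Definition unique_tangents (R : realType) (C : set (plane R)) : Prop :=
  forall z, C z -> exists! T, tangent_line C z T.

(* The half-plane is closed, so a point u of C sees itself via z = u; this
   affects at most one z for each u. *)
Definition sees_itself (R : realType) (C : set (plane R)) (u z : plane R) :
  Prop :=
  exists T N, [/\ tangent_line C z T, normal_line T z N, N u &
    same_side T (C `|` [set u])].

Definition self_images (R : realType) (C : set (plane R)) (u : plane R) :
  set (plane R) := [set z | C z /\ sees_itself C u z].

(* Main.v *)
From mathcomp Require Import all_boot all_order all_algebra.
From mathcomp Require Import all_classical all_reals all_analysis.
From mathcomp Require Import ring lra.
Require Import Defs.

Set Implicit Arguments.
Unset Strict Implicit.
Unset Printing Implicit Defensive.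

Import Order.TTheory GRing.Theory Num.Theory.
Import numFieldNormedType.Exports.

Local Open Scope classical_set_scope.
Local Open Scope ring_scope.

(** Why it is true.  Fix a curve C bounding the convex body K, and a point u.
At a local maximum m of the distance to u on K, the line through m orthogonal
to m - u supports K, with u on the same side as K; hence u sees itself via m.
The feet m of C such that K lies in the half-plane through m with inner normal
u - m form a closed set, so it suffices to find a Cantor set of limits of local
maxima of the distance to u.

A strict local maximum can be recorded by a disc: K has a point inside the disc
which is farther from u than every point of K near the boundary circle of the
disc.  Such a peak, with its margin, survives small perturbations of K, u and
the disc, so discs with rational data suffice, and for each of them the pairs
(C, u) having a peak in it form an open set ([open_peaked]).  The key step is
that peaks can be doubled by an arbitrarily small change of C: if m is a
farthest point of K from u inside a disc, add to K two points a little farther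
away than m, slightly to the left and to the right of the line through u and m,
and take the convex hull ([two_sharp_peaks]).  If the two points are close
enough to each other compared with how far they stick out, each of them is a
strict local maximum.  Hence, for a given rational disc, the pairs (C, u) with
a peak in it but without peaks in two disjoint rational discs inside it form a
nowhere dense set ([nowhere_dense_unforked]).  For a pair avoiding these
countably many sets, every peak forks, the disc containing the whole of K
carries a peak to start from, and a Cantor scheme of nested discs, each
intersected with the compact set of feet above, produces continuum many feet
([continuum_self_images]).

So the good pairs are comeagre in the product of the space of curves and the
plane, and the Kuratowski-Ulam theorem ([comeagre_sections]) passes to most
points u for most curves C.

That most curves have unique tangents is the theorem of Klee: the curves having
a point with two unit outer normals at distance at least 1 / (k + 1) stay away
from the boundary of every parallel body of every convex body, since such a
body is a union of discs of a fixed radius, and these boundaries are dense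
([nowhere_dense_cornered]). *)

(** * Baire category *)

Section category.
Context {T : topologicalType}.
Implicit Types A B P : set T.

Lemma nowhere_denseS A B : A `<=` B -> nowhere_dense B -> nowhere_dense A.
Proof.
move=> AB; rewrite /nowhere_dense -!subset0; apply: subset_trans.
exact/interiorS/closure_subset.
Qed.

Lemma nowhere_dense_boundary P : open P -> nowhere_dense (closure P `\` P).
Proof.
move=> oP; rewrite /nowhere_dense -subset0 => x.
have cB : closed (closure P `\` P).
  by apply: closedI; [exact: closed_closure|exact: open_closedC].
rewrite -((closure_id _).1 cB) => xB; have [xP _] := interior_subset xB.
by have [y [Py [_]]] := xP _ xB.
Qed.

(** The form delivered by approximation arguments, which move a given point
slightly to one that A stays away from. *)
Lemma nowhere_dense_stay_away A :
  (forall (x : T) U, nbhs x U -> exists2 y : T, U y & nbhs y (~` A)) ->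
  nowhere_dense A.
Proof.
move=> h; rewrite /nowhere_dense -subset0 => x xA.
have [y yA nA] := h _ _ xA.
by have [z [Az]] := yA _ nA.
Qed.

(** Index sets other than [nat] occur (rational discs, pairs), so the union is
re-indexed along an injection of the index set into [nat]. *)
Lemma meagre_bigcup (I : Type) (D : set I) (F : I -> set T) A :
  countable D -> (forall i, D i -> nowhere_dense (F i)) ->
  A `<=` \bigcup_(i in D) F i -> meagre A.
Proof.
move=> /countable_injP[f finj] nF AF.
exists (fun n => \bigcup_(i in D `&` f @^-1` [set n]) F i); split=> [n|x Ax].
  have [[i [Di fin]]|none] := pselect ((D `&` f @^-1` [set n]) !=set0).
    apply: nowhere_denseS (nF _ Di) => x [j [Dj fjn]].
    by rewrite (finj j i)// ?inE// fjn fin.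
  rewrite (_ : \bigcup_(i in _) _ = set0).
    by rewrite /nowhere_dense closure0; exact: interior0.
  by rewrite -subset0 => x [i Di _]; apply: none; exists i.
by have [i Di Fix] := AF _ Ax; exists (f i) => //; exists i.
Qed.

Lemma meagreU A B : meagre A -> meagre B -> meagre (A `|` B).
Proof.
move=> [F [nF AF]] [G [nG BG]].
apply: (@meagre_bigcup (nat + nat)%type setT
  (fun s => match s with inl n => F n | inr n => G n end)) => //.
- by case.
- move=> x [/AF[n _ ?]|/BG[n _ ?]]; first by exists (inl n).
  by exists (inr n).
Qed.

End category.

(** One half of the Kuratowski-Ulam theorem.  If the section of a closed nowhere
dense set F at x is not nowhere dense, it contains a member V of the countable
basis; the x for which it contains a given V form a closed set, whose interior
times V is an open subset of F, hence empty. *)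
Theorem comeagre_sections (X Y : topologicalType) (E : set (X * Y)) :
  @second_countable Y -> comeagre E ->
  comeagre [set x | comeagre [set y | E (x, y)]].
Proof.
move=> [B cB [oB bB]] [F [nF EF]].
pose sect n x := [set y | closure (F n) (x, y)].
have clY n x : closed (sect n x).
  have cts : continuous (fun y : Y => (x, y)).
    by move=> y; apply: cvg_pair => //=; exact: cvg_cst.
  by apply: preimage_closed (@closed_closure _ (F n)) => y _; exact: cts.
have clX n y : closed [set x | sect n x y].
  have cts : continuous (fun x : X => (x, y)).
    by move=> x; apply: cvg_pair => //=; exact: cvg_cst.
  by apply: preimage_closed (@closed_closure _ (F n)) => x _; exact: cts.
pose bad (i : nat * set Y) := [set x | i.2 `<=` sect i.1 x].
apply: (@meagre_bigcup _ _ [set i | B i.2 /\ i.2 !=set0] bad).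
- apply: (@sub_countable _ _ _ (setT `*` B)); last exact: countableX.
  by apply: subset_card_le => -[n V] [].
- move=> [n V] [/= BV [v Vv]].
  have clbad : closed (bad (n, V)).
    have -> : bad (n, V) = \bigcap_(y in V) [set x | sect n x y].
      by apply/seteqP; split=> x h y /h.
    by apply: closed_bigI => y _; exact: clX.
  rewrite /nowhere_dense -((closure_id _).1 clbad) -subset0 => x xbad.
  suff : interior (closure (F n)) (x, v) by rewrite nF.
  exists (interior (bad (n, V)), V).
    by split; [exact: nbhs_interior|exact/open_nbhs_nbhs/(conj (oB _ BV))].
  by move=> [x' y'] [/= /interior_subset x'bad Vy']; exact: x'bad.
- move=> x /= xE; apply: contrapT => nbad; apply: xE.
  exists (sect^~ x); split=> [n|y].
    rewrite /nowhere_dense -((closure_id _).1 (clY n x)) -subset0 => y yF.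
    have [V [BV Vy] VF] := bB _ _ yF.
    by apply: nbad; exists (n, V) => //; split=> //; exists y.
  by move=> /= /EF[n _ Fnxy]; exists n => //; exact: subset_closure.
Qed.

(** * Cantor schemes and the cardinality of the continuum *)

Lemma nested_compact_nonempty (T : topologicalType) (A : nat -> set T) :
  compact (A 0%N) -> (forall n, closed (A n)) -> (forall n, A n !=set0) ->
  (forall n, A n.+1 `<=` A n) -> \bigcap_n A n !=set0.
Proof.
move=> cA0 clA A0 dec.
have mono m n : (m <= n)%N -> A n `<=` A m.
  elim: n => [|n IH]; first by rewrite leqn0 => /eqP ->.
  rewrite leq_eqVlt => /predU1P[-> //|]; rewrite ltnS => /IH.
  exact: subset_trans (dec n).
have PF : ProperFilter (filter_from setT A).
  apply: filter_from_proper => [|i _]; last exact: A0.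
  apply: filter_from_filter; first by exists 0%N.
  move=> i j _ _; exists (maxn i j) => // x Ax.
  by split; apply: mono Ax; rewrite ?leq_maxl ?leq_maxr.
have [|p [_ clp]] := cA0 _ PF; first by exists 0%N.
exists p => n _; apply: clA => U pU; apply: clp => //.
by exists n.
Qed.

(** A branch of the binary tree of splittings gives a decreasing sequence of
nonempty compact sets; a common point is chosen for each branch, and disjoint
siblings make the choice injective.  The diameters need not tend to 0. *)
Lemma cantor_scheme (T : topologicalType) (I : Type) (P : set I)
    (A : I -> set T) (i0 : I) :
  hausdorff_space T -> P i0 ->
  (forall i, P i -> compact (A i) /\ A i !=set0) ->
  (forall i, P i -> exists j k, [/\ P j, P k, A j `<=` A i, A k `<=` A i &
    A j `&` A k = set0]) ->
  ([set: nat -> bool] #<= A i0)%card.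
Proof.
move=> hT Pi0 cA splitA.
have [s sP] : exists s : I -> bool -> I, forall i, P i ->
    [/\ forall b, P (s i b), forall b, A (s i b) `<=` A i &
        A (s i false) `&` A (s i true) = set0].
  suff /choice[s sP] : forall i, exists s : bool -> I, P i ->
    [/\ forall b, P (s b), forall b, A (s b) `<=` A i &
        A (s false) `&` A (s true) = set0] by exists s.
  move=> i; have [Pi|nPi] := pselect (P i); last by exists (fun=> i).
  have [j [k [Pj Pk ji ki jk]]] := splitA _ Pi.
  by exists (fun b => if b then k else j); split=> // -[].
pose node := fix node (x : nat -> bool) n :=
  if n is m.+1 then s (node x m) (x m) else i0.
have Pnode x n : P (node x n).
  by elim: n => //= n /sP[]; exact.
have /choice[f fP] x : exists p, forall n, A (node x n) p.
  have [] := @nested_compact_nonempty _ (fun n => A (node x n)).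
  - exact: (cA _ Pi0).1.
  - by move=> n; apply: compact_closed => //; exact: (cA _ (Pnode x n)).1.
  - by move=> n; exact: (cA _ (Pnode x n)).2.
  - by move=> n; have [_ + _] := sP _ (Pnode x n); exact.
  - by move=> p pA; exists p => n; exact: pA.
have finj : injective f.
  move=> x y fxy; apply/funext => n; elim/ltn_ind: n => n IH.
  have nxy m : (m <= n)%N -> node x m = node y m.
    elim: m => //= m IHm mn; rewrite IHm ?(ltnW mn)// IH//.
  have := fP x n.+1; have := fP y n.+1; rewrite /= -fxy nxy//.
  have [_ _ dis] := sP _ (Pnode y n).
  by case: (x n) (y n) => -[] // a b; exfalso; rewrite -[False]/(set0 (f x)) -dis.
have [|g] := (@injfunPex _ _ [set: nat -> bool] (A i0)).2; last exact: inj_card_le.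
by exists f => [x _|x y _ _ /finj//]; exact: (fP x 0%N).
Qed.

(** The triadic Cantor set, as the scheme of the outer thirds of intervals. *)
Lemma card_bool_seq_le_R (R : realType) : ([set: nat -> bool] #<= [set: R])%card.
Proof.
pose A (i : R * R) := `[i.1, i.2]%classic.
have: ([set: nat -> bool] #<= A (0, 1))%card.
  apply: (@cantor_scheme _ _ [set i : R * R | i.1 < i.2]) => /=.
  - exact: Rhausdorff.
  - exact: ltr01.
  - move=> [a b] /= ab; split; first exact: segment_compact.
    by exists a; rewrite /A /= in_itv/= lexx ltW.
  - move=> [a b] /= ab.
    exists (a, a + (b - a) / 3), (b - (b - a) / 3, b) => /=; split.
    + lra.
    + lra.
    + by move=> x; rewrite /A /= !in_itv/= => /andP[]; lra.
    + by move=> x; rewrite /A /= !in_itv/= => /andP[]; lra.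
    + rewrite -subset0 => x [] ; rewrite /A /= !in_itv/= => /andP[] ? ? /andP[]; lra.
move=> /card_le_trans; apply; exact: card_leT.
Qed.

(** A vector is determined by the rational cuts of its coordinates. *)
Lemma card_rV_le_bool_seq (R : realType) n :
  ([set: 'rV[R]_n] #<= [set: nat -> bool])%card.
Proof.
pose cut (v : 'rV[R]_n) (k : nat) : bool :=
  if (unpickle k : option ('I_n * rat)) is Some (i, q) then v 0 i < ratr q
  else false.
have [|g] := (@injfunPex _ _ [set: 'rV[R]_n] [set: nat -> bool]).2;
  last exact: inj_card_le.
exists cut => // v w _ _ vw; apply/rowP => i.
have key q : (v 0 i < ratr q) = (w 0 i < ratr q).
  by have := congr1 (fun f => f (pickle (i, q))) vw; rewrite /cut pickleK.
case: (ltgtP (v 0 i) (w 0 i)) => // /rat_in_itvoo[q]; rewrite in_itv/= => /andP[].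
  by rewrite key => /lt_trans/[apply]; rewrite ltxx.
by rewrite -key => /lt_trans/[apply]; rewrite ltxx.
Qed.

Lemma continuum_of_bool_seq (R : realType) n (A : set 'rV[R]_n) :
  ([set: nat -> bool] #<= A)%card -> (A #= [set: R])%card.
Proof.
move=> bA; apply/card_eqPle; split.
  apply: card_le_trans (card_bool_seq_le_R R).
  exact: card_le_trans (card_leT _) (card_rV_le_bool_seq R n).
apply: card_le_trans bA; apply: card_le_trans (card_rV_le_bool_seq R 1).
have [|g] := (@injfunPex _ _ [set: R] [set: 'rV[R]_1]).2; last exact: inj_card_le.
by exists (fun x => const_mx x) => // x y _ _ /rowP/(_ 0); rewrite !mxE.
Qed.

(** * The Euclidean plane *)

Section euclidean.
Context {R : realType}.
Implicit Types (u v w x y z p : 'rV[R]_2) (K : set 'rV[R]_2) (t : R).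

Lemma dotC u v : dot u v = dot v u.
Proof. by rewrite !dotE; ring. Qed.

Lemma dotZl t u v : dot (t *: u) v = t * dot u v.
Proof. by rewrite !dotE !mxE; ring. Qed.

Lemma dotNr u v : dot u (- v) = - dot u v.
Proof. by rewrite !dotE !mxE; ring. Qed.

Lemma enorm_sqr u : enorm u ^+ 2 = dot u u.
Proof. by rewrite sqr_sqrtr// dotuu_ge0. Qed.

Lemma enormZ t u : enorm (t *: u) = `|t| * enorm u.
Proof. by rewrite /enorm dotZl dotC dotZl mulrA -expr2 sqrtrM ?sqr_ge0// sqrtr_sqr. Qed.

Lemma dotuu_eq0 u : (dot u u == 0) = (u == 0).
Proof.
apply/eqP/eqP => [|->]; last by rewrite dotE !mxE; ring.
rewrite dotE -!expr2 => /eqP; rewrite paddr_eq0 ?sqr_ge0// !sqrf_eq0.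
move=> /andP[/eqP u0 /eqP u1]; apply/rowP => -[[|[|//]] i]; rewrite mxE.
  by rewrite -u0; congr (u _ _); exact/val_inj.
by rewrite -u1; congr (u _ _); exact/val_inj.
Qed.

Lemma enorm_eq0 u : (enorm u == 0) = (u == 0).
Proof. by rewrite -dotuu_eq0 -enorm_sqr sqrf_eq0. Qed.

Lemma enorm_gt0 u : (0 < enorm u) = (u != 0).
Proof. by rewrite lt_neqAle enorm_ge0 andbT eq_sym enorm_eq0. Qed.

Lemma dot_le_enorm u v : dot u v <= enorm u * enorm v.
Proof.
rewrite -sqrtrM ?dotuu_ge0// (le_trans (ler_norm _))// -sqrtr_sqr.
rewrite ler_wsqrtr// !dotE -subr_ge0.
set a := u 0 0; set b := u 0 1; set c := v 0 0; set d := v 0 1.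
rewrite (_ : _ - _ = (a * d - b * c) ^+ 2) ?sqr_ge0//; ring.
Qed.

Lemma edist_ge0 x y : 0 <= edist x y. Proof. exact: enorm_ge0. Qed.

Lemma edist_gt0 x y : (0 < edist x y) = (x != y).
Proof. by rewrite /edist enorm_gt0 subr_eq0. Qed.

Lemma edist_le_dot x y u v :
  (edist x y <= edist u v) = (dot (x - y) (x - y) <= dot (u - v) (u - v)).
Proof. by rewrite /edist /enorm ler_sqrt// dotuu_ge0. Qed.

Lemma nbhs_edistP x (U : set 'rV[R]_2) :
  nbhs x U <-> exists2 e, 0 < e & forall y, edist x y < e -> U y.
Proof.
split=> [/nbhs_ballP[e /= e0 eU]|[e e0 eU]].
  exists e => // y xy; apply: eU; split=> // i j; rewrite (ord1 i) /ball/=.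
  by have := coord_le_enorm (x - y) j; rewrite !mxE => /le_lt_trans; exact.
apply/nbhs_ballP; exists (e / 2) => /=; first by rewrite divr_gt0.
move=> y; rewrite -ball_normE /= => xy; apply: eU.
apply: le_lt_trans (enorm_le_norm _) _; rewrite -mulr_natl; lra.
Qed.

Lemma continuous_dot (T : topologicalType) (f g : T -> 'rV[R]_2) :
  continuous f -> continuous g -> continuous (fun s => dot (f s) (g s) : R).
Proof.
move=> cf cg.
have c h j : continuous h -> continuous (fun s : T => (h s : 'rV[R]_2) 0 j : R).
  by move=> ch s; apply: (@continuous_comp _ _ _ h (fun M : 'rV[R]_2 => M 0 j));
    [exact: ch|exact: coord_continuous].
have -> : (fun s => dot (f s) (g s)) =
    (fun s => f s 0 0 * g s 0 0 + f s 0 1 * g s 0 1).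
  by apply/funext => s; rewrite dotE.
by move=> s; apply: cvgD; apply: cvgM; exact: c.
Qed.

Lemma closed_dot_ge (T : topologicalType) (f g : T -> 'rV[R]_2) t :
  continuous f -> continuous g -> closed [set s | t <= dot (f s) (g s)].
Proof.
move=> cf cg.
have := @closed_ge R t.
by apply: preimage_closed => s _; exact: continuous_dot.
Qed.

Lemma convex_setP K : convex_set K <->
  forall x y t, K x -> K y -> 0 <= t -> t <= 1 -> K (x + t *: (y - x)).
Proof.
split=> [cK x y t Kx Ky t0 t1|cK x y l].
  pose l := Itv01 t0 t1.
  have := cK y x l; rewrite !inE => /(_ Ky Kx).
  suff <- : conv l (y : convex_lmodType 'rV[R]_2) x = x + t *: (y - x) by [].
  by apply/rowP => i; rewrite !mxE /= /unstable.onem; ring.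
rewrite !inE => Kx Ky.
suff -> : conv l x y = y + l%:num *: (x - y) :> 'rV[R]_2 by exact: cK.
by apply/rowP => i; rewrite !mxE /= /unstable.onem; ring.
Qed.
End euclidean.

(** * Extremal distances and boundary crossings of compact sets *)

Section convex_bodies.
Context {R : realType}.
Implicit Types (u v w x y z p : 'rV[R]_2) (K C A B : set 'rV[R]_2) (t e : R).

Lemma compact_closed_rV K : compact K -> closed K.
Proof. by apply: compact_closed; exact: norm_hausdorff. Qed.

Lemma compact_edist_bounded K : compact K ->
  exists2 D, 0 < D & forall x y, K x -> K y -> edist x y <= D.
Proof.
move=> /compact_bounded[M [_ KM]].
have KM1 : forall x, K x -> enorm x <= (M + 1) *+ 2.
  move=> x Kx; apply: (le_trans (enorm_le_norm x)); rewrite lerMn2r/=.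
  by apply: KM => //; rewrite ltrDl.
exists (`|(M + 1) *+ 2| + `|(M + 1) *+ 2| + 1).
  by rewrite ltr_wpDl// addr_ge0.
move=> x y /KM1 xM /KM1 yM; rewrite /edist (le_trans (enormD _ _))// enormN.
have := ler_norm ((M + 1) *+ 2).
by move: xM yM; set a := _ *+ 2; lra.
Qed.

Lemma farthest_point A u : compact A -> A !=set0 ->
  exists2 p, A p & forall w, A w -> edist w u <= edist p u.
Proof.
move=> cA A0.
have cf : continuous (fun v : 'rV[R]_2 => dot (v - u) (v - u) : R).
  by apply: (@continuous_dot _ _ (fun v => v - u)) => v; exact: cvgB cvg_id (cvg_cst _).
have [p /set_mem Ap pmax] := EVT_max_rV A0 cA (continuous_subspaceT cf).
by exists p => // w /mem_set/pmax; rewrite edist_le_dot.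
Qed.

Lemma nearest_point A u : compact A -> A !=set0 ->
  exists2 p, A p & forall w, A w -> edist p u <= edist w u.
Proof.
move=> cA A0.
have cf : continuous (fun v : 'rV[R]_2 => dot (v - u) (v - u) : R).
  by apply: (@continuous_dot _ _ (fun v => v - u)) => v; exact: cvgB cvg_id (cvg_cst _).
have [p /set_mem Ap pmax] := EVT_min_rV A0 cA (continuous_subspaceT cf).
by exists p => // w /mem_set/pmax; rewrite edist_le_dot.
Qed.

(** The nearest point p of K to y has the outer normal y - p: otherwise moving
from p towards a point of K would decrease the distance to y. *)
Lemma outer_normal K y : convex_set K -> compact K -> K !=set0 -> ~ K y ->
  exists p n, [/\ K p, forall w, K w -> edist p y <= edist w y,
    enorm n = 1 & forall w, K w -> dot (w - p) n <= 0].
Proof.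
move=> /convex_setP vK cK K0 nKy.
have [p Kp pmin] := nearest_point y cK K0.
have py : y != p by apply: contra_notN nKy => /eqP ->.
have d0 : 0 < edist y p by rewrite edist_gt0.
exists p, ((edist y p)^-1 *: (y - p)); split=> //.
  rewrite enormZ ger0_norm ?invr_ge0 ?(ltW d0)//.
  by rewrite mulVf// gt_eqF.
move=> w Kw; rewrite dotC dotZl pmulr_rle0 ?invr_gt0// dotC leNgt.
apply/negP => a0; set a := dot _ _ in a0; pose b := dot (w - p) (w - p).
have b0 : 0 <= b by exact: dotuu_ge0.
(* the vertex of the parabola t |-> |p + t (w - p) - y|^2, moved into [0, 1] *)
pose t := a / (a + b).
have ab : 0 < a + b by lra.
have t0 : 0 < t by rewrite divr_gt0.
have t1 : t <= 1 by rewrite ler_pdivrMr//; lra.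
have := pmin _ (vK _ _ _ Kp Kw (ltW t0) t1); rewrite edist_le_dot leNgt => /negP; apply.
have -> : dot (p + t *: (w - p) - y) (p + t *: (w - p) - y) =
    dot (p - y) (p - y) - t * (2 * a - t * b).
  by rewrite /a /b !dotE !mxE; ring.
rewrite ltrBlDr ltrDl mulr_gt0//.
have : t * (a + b) = a by rewrite /t divfK// gt_eqF.
have : 0 < t * a by rewrite mulr_gt0.
by nra.
Qed.

Lemma frontierE K : closed K -> frontier K = K `\` interior K.
Proof. by move=> cK; rewrite /frontier -(closure_id _).1. Qed.

(** The last point of K on the segment from x to y is on the frontier. *)
Lemma frontier_crossing K x y : closed K -> K x -> ~ K y ->
  exists2 t, 0 <= t <= 1 & frontier K (x + t *: (y - x)).
Proof.
move=> cK Kx nKy; rewrite frontierE//.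
pose g t := x + t *: (y - x).
have cg : continuous g.
  move=> t; apply: cvgD; first exact: cvg_cst.
  by apply: cvgZr_tmp.
pose S := `[0, 1]%classic `&` g @^-1` K.
have cS : compact S.
  apply: compact_closedI; first exact: segment_compact.
  by apply: preimage_closed cK => t _; exact: cg.
have S0 : S 0.
  by split; rewrite /= ?in_itv/= ?lexx ?ler01// /g scale0r addr0.
have [||t /set_mem[+ +] tmax] := @compact_EVT_max _ _ id S _ cS.
- by exists 0.
- by apply: continuous_subspaceT => s; exact: cvg_id.
rewrite /= in_itv/= => /andP[t0 t1] Kt; exists t; first by rewrite t0.
split=> // /nbhs_edistP[e e0 eK].
have {}t1 : t < 1.
  rewrite lt_neqAle t1 andbT; apply: contra_not_neq nKy => t1'.
  by move: Kt; rewrite /g t1' scale1r addrC subrK.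
have d0 : 0 <= edist y x by exact: edist_ge0.
pose s := Num.min (1 - t) (e / (edist y x + 1) / 2).
have s0 : 0 < s by rewrite lt_min subr_gt0 t1 !divr_gt0// ltr_wpDl.
have : t + s <= t.
  apply: tmax; apply/mem_set; split.
    have : s <= 1 - t by rewrite ge_min lexx.
    by rewrite /= in_itv/=; lra.
  apply: eK.
  have -> : edist (x + t *: (y - x)) (g (t + s)) = s * edist y x.
    rewrite /edist -[s in RHS]ger0_norm ?(ltW s0)// -enormZ -enormN.
    by congr enorm; apply/rowP => i; rewrite !mxE; ring.
  have sle : s <= e / (edist y x + 1) / 2 by rewrite ge_min lexx orbT.
  have : s * (edist y x + 1) <= e / 2.
    by rewrite -ler_pdivlMr ?ltr_wpDl// mulrAC.
  nra.
by rewrite gerDl leNgt s0.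
Qed.

End convex_bodies.

(** * Convex curves and the bodies that they bound *)

Section curves.
Context {R : realType}.
Implicit Types (u v w x y z p n : 'rV[R]_2) (K A B : set 'rV[R]_2) (t e : R).

Lemma edist_segl x y t : 0 <= t <= 1 -> edist x (x + t *: (y - x)) <= edist x y.
Proof.
move=> /andP[t0 t1]; rewrite /edist -(enormN (x - y)) -(enormN (x - _)).
rewrite opprB addrAC subrr add0r enormZ opprB ger0_norm//.
by rewrite ler_piMl// enorm_ge0.
Qed.

Lemma edist_segr x y t : 0 <= t <= 1 -> edist (x + t *: (y - x)) y <= edist x y.
Proof.
move=> t01; rewrite edistC (edistC x).
rewrite (_ : x + _ = y + (1 - t) *: (x - y)); first by apply: edist_segl; lra.
by apply/rowP => i; rewrite !mxE; ring.
Qed.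

Lemma frontier_approx_out K z e : compact K -> frontier K z -> 0 < e ->
  exists2 y, ~ K y & edist z y < e.
Proof.
move=> /compact_closed_rV/frontierE -> [Kz nIz] e0; apply: contrapT => h; apply: nIz.
apply/nbhs_edistP; exists e => // y zy; apply: contrapT => nKy.
by apply: h; exists y.
Qed.

Lemma frontier_sub K : compact K -> frontier K `<=` K.
Proof. by move=> /compact_closed_rV/frontierE -> x []. Qed.

Lemma compact_circle : compact [set n : 'rV[R]_2 | enorm n = 1].
Proof.
apply: bounded_closed_compact.
  exists 1; split; first exact: num_real.
  move=> M M1 n /= n1; rewrite [leLHS]/Num.norm/= mx_normrE.
  apply: bigmax_le => [|[i j] _ /=]; first by rewrite (le_trans ler01)// ltW.
  by rewrite (ord1 i) (le_trans (coord_le_enorm _ _))// n1 ltW.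
have -> : [set n : 'rV[R]_2 | enorm n = 1] =
    (fun n => dot n n) @^-1` [set 1 : R].
  apply/seteqP; split=> n /= n1; first by rewrite -enorm_sqr n1 expr1n.
  by rewrite /enorm n1 sqrtr1.
apply: preimage_closed (@closed_eq _ _) => n _.
by apply: (@continuous_dot _ _ id id) => ?; exact: cvg_id.
Qed.

(** Points outside K and close to z have nearest points in K close to z, with
outer normals that nearly support K at z.  For an error 1 / (k + 1), the unit
vectors supporting K at z up to this error form a compact set F k, and these
sets are nested: a vector in all of them supports K at z. *)
Lemma supporting_normal K z : convex_set K -> compact K -> frontier K z ->
  exists2 n, enorm n = 1 & forall w, K w -> dot (w - z) n <= 0.
Proof.
move=> vK cK fz; have Kz := frontier_sub cK fz.
pose F k := [set n : 'rV[R]_2 | enorm n = 1] `&`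
  \bigcap_(w in K) [set n | - k.+1%:R^-1 <= dot (z - w) n].
have clF k : closed (\bigcap_(w in K) [set n : 'rV[R]_2 | - k.+1%:R^-1 <= dot (z - w) n]).
  apply: closed_bigI => w _; apply: (@closed_dot_ge _ _ (fun=> z - w) id) => n.
    exact: cst_continuous.
  exact: cvg_id.
have cF k : compact (F k) by apply: compact_closedI; [exact: compact_circle|].
have [|||k n [n1 nk]|n nF] := @nested_compact_nonempty _ F.
- exact: cF.
- by move=> k; apply: compact_closed_rV; exact: cF.
- move=> k; have k0 : 0 < k.+1%:R^-1 / 2 :> R by rewrite divr_gt0.
  have [y nKy zy] := frontier_approx_out cK fz k0.
  have [|p [n [Kp pmin n1 nK]]] := outer_normal vK cK _ nKy; first by exists z.
  exists n; split=> // w Kw /=.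
  have -> : dot (z - w) n = - dot (w - p) n - dot (p - z) n.
    by rewrite !dotE !mxE; ring.
  have := dot_le_enorm (p - z) n; rewrite n1 mulr1 -/(edist p z).
  have := edist_triangle y p z; rewrite (edistC y z).
  have := pmin _ Kz; have := nK _ Kw; move: zy; set d := k.+1%:R^-1; lra.
- split=> // w Kw /=; have := nk _ Kw => /=; apply: le_trans.
  by rewrite lerN2 lef_pV2 ?posrE// ler_nat.
exists n; first by have [] := nF 0%N I.
move=> w Kw; rewrite leNgt; apply/negP => wn.
have [k /ltW kn] : exists k, k.+1%:R^-1 < dot (w - z) n / 2.
  have [|k] := @ltr_add_invr _ 0 (dot (w - z) n / 2); first by rewrite divr_gt0.
  by rewrite add0r; exists k.
have [_ /(_ _ Kw) /=] := nF k I.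
rewrite (_ : dot (z - w) n = - dot (w - z) n); last by rewrite !dotE !mxE; ring.
move: kn; set d := k.+1%:R^-1; lra.
Qed.

(** For a closed convex curve this is the convex body that it bounds, recovered
without a choice. *)
Definition chords A : set 'rV[R]_2 := [set x | exists a b t,
  [/\ A a, A b, 0 <= t <= 1 & x = a + t *: (b - a)]].

(** A line through a point of K leaves K on both sides, because K is bounded. *)
Lemma chords_frontier K : convex_set K -> compact K -> chords (frontier K) = K.
Proof.
move=> /convex_setP vK cK; have fK := frontier_sub cK; apply/seteqP; split=> [x|p Kp].
  by move=> [a [b [t [/fK Ka /fK Kb /andP[t0 t1] ->]]]]; exact: vK.
have [D D0 DK] := compact_edist_bounded cK.
(* longer than the diameter of K, so that p +- q is outside K *)
pose q : 'rV[R]_2 := \row_j (D + 1).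
have Dq : D < enorm q.
  apply: lt_le_trans (coord_le_enorm q 0); rewrite mxE ger0_norm; lra.
have out s : `|s| = 1 -> ~ K (p + s *: q).
  move=> s1 /(DK _ _ Kp); rewrite /edist opprD addrA subrr sub0r enormN enormZ s1.
  by rewrite mul1r leNgt Dq.
have clK := compact_closed_rV cK.
have [|a /andP[a0 a1] fa] := frontier_crossing clK Kp (out 1 _); first exact: normr1.
have [|b /andP[b0 b1] fb] := frontier_crossing clK Kp (out (-1) _); first exact: normrN1.
have [ab|ab] := eqVneq (a + b) 0.
  exists (p + a *: (p + 1 *: q - p)), (p + a *: (p + 1 *: q - p)), 0; split=> //.
    by rewrite lexx ler01.
  have -> : a = 0 by lra.
  by rewrite !scale0r !addr0.
have ab0 : 0 < a + b by rewrite lt_neqAle eq_sym ab/= addr_ge0.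
exists (p + a *: (p + 1 *: q - p)), (p + b *: (p + -1 *: q - p)), (a / (a + b)).
split=> //.
  by rewrite divr_ge0 ?addr_ge0//= ler_pdivrMr//; lra.
by apply/rowP => i; rewrite !mxE; field.
Qed.

Lemma curve_chords (C : curve R) : [/\ convex_set (chords C), compact (chords C),
  interior (chords C) !=set0 & curve_set C = frontier (chords C)].
Proof.
by case: C => C /= [K [vK cK iK ->]]; rewrite chords_frontier.
Qed.

Lemma thickening_convex K e : convex_set K -> convex_set (thickening e K).
Proof.
move=> /convex_setP vK; apply/convex_setP => x y t [a Ka xa] [b Kb yb] t0 t1.
exists (a + t *: (b - a)); first exact: vK.
rewrite /edist (_ : _ - _ = (1 - t) *: (x - a) + t *: (y - b)).
  rewrite (le_trans (enormD _ _))// !enormZ !ger0_norm ?subr_ge0//.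
  have : (1 - t) * edist x a <= (1 - t) * e by rewrite ler_wpM2l// subr_ge0.
  have : t * edist y b <= t * e by rewrite ler_wpM2l.
  rewrite /edist; lra.
by apply/rowP => i; rewrite !mxE; ring.
Qed.

Lemma thickening_self A e : 0 <= e -> A `<=` thickening e A.
Proof. by move=> e0 x Ax; exists x => //; rewrite edistxx. Qed.

(** Boundedness of the curves matters here: it makes the set of radii nonempty,
so that its infimum is approached. *)
Lemma hausdorff_lt (C C' : curve R) e : hausdorff_dist C C' < e ->
  curve_set C `<=` thickening e C' /\ curve_set C' `<=` thickening e C.
Proof.
move=> CC'e.
have E0 : [set d | [/\ 0 <= d, curve_set C `<=` thickening d C' &
    curve_set C' `<=` thickening d C]] !=set0.
  have [_ cC _ _] := curve_chords C; have [_ cC' _ _] := curve_chords C'.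
  have [M1 h1] := curve_bounded C; have [M2 h2] := curve_bounded C'.
  have [c1 m1] := curve_nonempty C; have [c2 m2] := curve_nonempty C'.
  have d x y : curve_set C x -> curve_set C' y -> edist x y <= M1 + M2.
    move=> /h1 xM /h2 yM; rewrite /edist (le_trans (enormD _ _))// enormN.
    exact: lerD.
  exists (M1 + M2); split.
  - exact: le_trans (enorm_ge0 _) (d _ _ m1 m2).
  - by move=> x xC; exists c2 => //; exact: d.
  - by move=> x xC; exists c1 => //; rewrite edistC; exact: d.
have hi : has_inf [set d | [/\ 0 <= d, curve_set C `<=` thickening d C' &
    curve_set C' `<=` thickening d C]] by split=> //; exists 0 => d [].
have e0 : 0 < e - hausdorff_dist C C' by rewrite subr_gt0.
have [d [d0 h1 h2]] := inf_adherent e0 hi.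
rewrite -/(hausdorff_dist C C') addrC subrK => /ltW de.
have le A : thickening d A `<=` thickening e A.
  by move=> x [a Aa xa]; exists a => //; exact: le_trans de.
by split; [apply: subset_trans h1 _|apply: subset_trans h2 _].
Qed.

Lemma hausdorff_le A B e : 0 <= e -> A `<=` thickening e B ->
  B `<=` thickening e A -> hausdorff_dist A B <= e.
Proof. by move=> e0 AB BA; apply: ge_inf => //; exists 0 => d []. Qed.

Lemma chords_thickening A B e :
  A `<=` thickening e B -> convex_set (chords B) ->
  chords A `<=` thickening e (chords B).
Proof.
move=> AB vB x [a [b [t [Aa Ab /andP[t0 t1] ->]]]].
have BB : B `<=` chords B.
  move=> y By; exists y, y, 0; split=> //; first by rewrite lexx ler01.
  by rewrite scale0r addr0.
have AcB : A `<=` thickening e (chords B).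
  by move=> y /AB[c /BB Bc yc]; exists c.
have /convex_setP := thickening_convex (e := e) vB; apply => //; exact: AcB.
Qed.

(** Closeness of two curves gives closeness of the bodies that they bound, since
thickenings of convex sets are convex. *)
Lemma hausdorff_lt_chords (C C' : curve R) e : hausdorff_dist C C' < e ->
  chords C `<=` thickening e (chords C') /\
  chords C' `<=` thickening e (chords C).
Proof.
move=> /hausdorff_lt[h1 h2]; have [vC _ _ _] := curve_chords C.
by have [vC' _ _ _] := curve_chords C'; split; apply: chords_thickening.
Qed.

(** The less obvious half is that a boundary point x of K is close to the boundary
of K': near x there is an outer normal n of K at some p, and p + 2 e n is too
far from K to lie in K', so the segment from x to it crosses the boundary of
K'. *)
Lemma frontier_hausdorff K K' e :
  convex_set K -> compact K -> compact K' -> 0 < e ->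
  K `<=` K' -> K' `<=` thickening e K ->
  hausdorff_dist (frontier K) (frontier K') <= 4 * e.
Proof.
move=> vK cK cK' e0 KK' K'K.
have clK := compact_closed_rV cK; have clK' := compact_closed_rV cK'.
apply: hausdorff_le; first by rewrite mulr_ge0// ltW.
- move=> x fx; have Kx := frontier_sub cK fx.
  have [y nKy xy] := frontier_approx_out cK fx e0.
  have [|p [n [Kp pmin n1 nK]]] := outer_normal vK cK _ nKy; first by exists x.
  pose q := p + (2 * e) *: n.
  have nK'q : ~ K' q.
    move=> /K'K[k Kk qk]; have := dot_le_enorm (q - k) n.
    rewrite n1 mulr1 -/(edist q k).
    have -> : dot (q - k) n = 2 * e * (enorm n ^+ 2) - dot (k - p) n.
      by rewrite enorm_sqr !dotE !mxE; ring.
    by have := nK _ Kk; rewrite n1; lra.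
  have [t t01 fq] := frontier_crossing clK' (KK' _ Kx) nK'q.
  exists (x + t *: (q - x)) => //; apply: le_trans (edist_segl _ _ t01) _.
  have : edist q p = 2 * e.
    by rewrite /edist addrAC subrr add0r enormZ n1 mulr1 ger0_norm ?mulr_ge0// ltW.
  have := edist_triangle p x q; have := edist_triangle y x p.
  have := pmin _ Kx; rewrite (edistC q p) (edistC p y); lra.
- move=> x fx; have [K'x nIx] : (K' `\` interior K') x by rewrite -frontierE.
  have [Kx|nKx] := pselect (K x).
    exists x; last by rewrite edistxx mulr_ge0// ltW.
    by rewrite frontierE//; split=> //; move=> Ix; apply: nIx; exact: (interiorS KK').
  have [k Kk xk] := K'K _ K'x.
  have [t t01 fq] := frontier_crossing clK Kk nKx.
  exists (k + t *: (x - k)) => //; rewrite edistC.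
  by apply: le_trans (edist_segr _ _ t01) _; rewrite edistC; lra.
Qed.

(** The source of all perturbations below, which enlarge a body by little. *)
Lemma nearby_curve (C : curve R) K e : convex_set K -> compact K -> 0 < e ->
  chords C `<=` K -> K `<=` thickening e (chords C) ->
  exists2 C' : curve R, chords C' = K & hausdorff_dist C C' <= 4 * e.
Proof.
move=> vK cK e0 CK KC; have [vC cC iC Cf] := curve_chords C.
have iK : interior K !=set0 by case: iC => x /(interiorS CK); exists x.
have PK : closed_convex_curve (frontier K) by exists K.
exists (Curve PK) => /=; first exact: chords_frontier.
by rewrite {1}Cf; exact: frontier_hausdorff.
Qed.

Lemma curve_ball (C C' : curve R) e : ball C e C' = (hausdorff_dist C C' < e).
Proof. by rewrite ballEmdist. Qed.

End curves.

(** * Most convex curves have unique tangents *)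

Section smoothness.
Context {R : realType}.
Implicit Types (u v w x y z p n m : 'rV[R]_2) (K A B : set 'rV[R]_2) (t e : R).

Definition outer_unit_normal K z n :=
  enorm n = 1 /\ forall w, K w -> dot (w - z) n <= 0.

Lemma chords_self A : A `<=` chords A.
Proof.
move=> y Ay; exists y, y, 0; split=> //; first by rewrite lexx ler01.
by rewrite scale0r addr0.
Qed.

Lemma line_tangent A z n : n != 0 -> (forall w, A w -> dot (w - z) n <= 0) ->
  tangent_line A z (line z n).
Proof.
move=> n0 An; split; first by exists z, n.
  by rewrite /line/= subrr dotE !mxE !mul0r addr0.
exists z, (- n); split; first by rewrite oppr_eq0.
  by apply/seteqP; split=> x; rewrite /line/= dotNr => /eqP;
    rewrite ?oppr_eq0 => /eqP; rewrite // => ->; rewrite ?oppr0.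
by move=> w /An; rewrite /half_plane/= dotNr oppr_ge0.
Qed.

Lemma tangent_lineE A z T : tangent_line A z T ->
  exists2 n, outer_unit_normal (chords A) z n & T = line z n.
Proof.
move=> [_ Tz [p [n [n0 TE AT]]]].
have zp : dot (z - p) n = 0 by move: Tz; rewrite TE.
have e0 : 0 < enorm n by rewrite enorm_gt0.
have dotn x : dot (x - z) (- ((enorm n)^-1 *: n)) = - ((enorm n)^-1 * dot (x - p) n).
  rewrite dotNr dotC dotZl dotC; congr (- (_ * _)).
  by rewrite -[RHS]subr0 -zp !dotE !mxE; ring.
exists (- ((enorm n)^-1 *: n)).
  split; first by rewrite enormN enormZ gtr0_norm ?invr_gt0// mulVf ?gt_eqF.
  move=> _ [a [b [t [/AT ap /AT bp /andP[t0 t1] ->]]]].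
  rewrite dotn oppr_le0 mulr_ge0 ?invr_ge0 ?(ltW e0)//.
  have -> : dot (a + t *: (b - a) - p) n = (1 - t) * dot (a - p) n + t * dot (b - p) n.
    by rewrite !dotE !mxE; ring.
  by rewrite addr_ge0// mulr_ge0// subr_ge0.
rewrite TE; apply/seteqP; split=> x; rewrite /line/= dotn.
  by move=> ->; rewrite mulr0 oppr0.
move=> /eqP; rewrite oppr_eq0 mulf_eq0 invr_eq0 gt_eqF//=.
by move=> /eqP.
Qed.

(** The non-smooth curves, graded by how far apart two unit normals at the same
point can be. *)
Definition cornered k : set (curve R) := [set C | exists z n m,
  [/\ curve_set C z, outer_unit_normal (chords C) z n,
      outer_unit_normal (chords C) z m & k.+1%:R^-1 <= edist n m]].

Lemma uncornered_unique_tangents (C : curve R) :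
  (forall k, ~ cornered k C) -> unique_tangents C.
Proof.
move=> nC z Cz; have [vC cC _ Cf] := curve_chords C.
have [|n n1 nz] := supporting_normal vC cC (z := z); first by rewrite -Cf.
have n0 : n != 0 by rewrite -enorm_gt0 n1 ltr01.
exists (line z n); split; first by apply: line_tangent => // w /chords_self/nz.
move=> T /tangent_lineE[m mz ->]; congr line; apply/eqP; apply: contrapT => /negP nm.
have [|k] := @ltr_add_invr _ 0 (edist n m); first by rewrite edist_gt0.
rewrite add0r => /ltW kn; apply: (nC k); exists z, n, m; split=> //.
Qed.

Lemma disc_compact e : compact [set v : 'rV[R]_2 | enorm v <= e].
Proof.
apply: bounded_closed_compact.
  exists e; split; first exact: num_real.
  move=> M eM v /= ve; rewrite [leLHS]/Num.norm/= mx_normrE.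
  apply: bigmax_le => [|[i j] _ /=].
    by rewrite (le_trans (enorm_ge0 v))// (le_trans ve)// ltW.
  by rewrite (ord1 i) (le_trans (coord_le_enorm _ _))// (le_trans ve)// ltW.
have [e0|e0] := leP 0 e; last first.
  rewrite (_ : mkset _ = set0); first exact: closed0.
  rewrite -subset0 => v /= /le_lt_trans/(_ e0).
  by rewrite ltNge enorm_ge0.
have -> : [set v : 'rV[R]_2 | enorm v <= e] =
    (fun n => dot n n) @^-1` [set s | s <= e ^+ 2].
  apply/seteqP; split=> n /=; rewrite -enorm_sqr.
    by rewrite ler_sqr ?nnegrE ?enorm_ge0.
  by rewrite ler_sqr ?nnegrE ?enorm_ge0.
apply: preimage_closed (@closed_le _ _) => n _.
by apply: (@continuous_dot _ _ id id) => ?; exact: cvg_id.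
Qed.

Lemma thickening_compact K e : compact K -> compact (thickening e K).
Proof.
move=> cK.
have -> : thickening e K =
    (fun q : 'rV[R]_2 * 'rV[R]_2 => q.1 + q.2) @` (K `*` [set v | enorm v <= e]).
  apply/seteqP; split=> [x [k Kk xk]|_ [[k v] [/= Kk ve] <-]].
    by exists (k, x - k) => //=; rewrite addrC subrK.
  by exists k => //; rewrite /edist addrAC subrr add0r.
apply: continuous_compact; last exact/compact_setX/disc_compact.
by apply: continuous_subspaceT => q; apply: cvgD; [exact: cvg_fst|exact: cvg_snd].
Qed.

(** Let C' bound the parallel body of C at distance h, and let L be at Hausdorff
distance less than d from C', where d is small compared with h.  A point z of L
is within h + d of a point a of the body of C, and the body of L nearly
contains the disc of radius h about a.  Hence a unit outer normal r of L at z
satisfies (z - a) . r >= h - d, which is almost the largest value that |z - a|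
allows: r almost has the direction of z - a, so two such normals are close. *)
Lemma nowhere_dense_cornered k : nowhere_dense (cornered k).
Proof.
apply: nowhere_dense_stay_away => C U /nbhs_ballP[e /= e0 eU].
have [vC cC _ _] := curve_chords C.
(* nearby_curve loses a factor 4, and the distance must be less than e *)
pose h := e / 8; have h0 : 0 < h by rewrite divr_gt0.
have [|C' C'E CC'] := nearby_curve (thickening_convex (e := h) vC)
  (thickening_compact (e := h) cC) h0 (thickening_self (ltW h0)).
  exact.
exists C'; first by apply: eU; rewrite curve_ball (le_lt_trans CC')// /h; lra.
pose c : R := k.+1%:R^-1.
have c0 : 0 < c by rewrite invr_gt0.
(* with d = x h, two normals have distance at least c only if
   (1 + x)^2 (4 - 32 x) >= 4 (1 - x)^2, which fails for x > 0 *)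
pose x := c ^+ 2 / 32; pose d := x * h.
have x0 : 0 < x by rewrite divr_gt0// exprn_gt0.
have d0 : 0 < d by rewrite mulr_gt0.
apply/nbhs_ballP; exists d => //= L; rewrite curve_ball => /hausdorff_lt_chords.
rewrite C'E => -[KL LK] [z [n [m [Lz [n1 nz] [m1 mz] cnm]]]].
have [z' [a Ka z'a] zz'] := LK _ (chords_self Lz).
have za : edist z a <= h + d by have := edist_triangle z' z a; lra.
have key r : enorm r = 1 -> (forall w, chords L w -> dot (w - z) r <= 0) ->
    h - d <= dot (z - a) r.
  move=> r1 rz.
  have [|l Ll al] := KL (a + h *: r).
    exists a => //; rewrite /edist addrAC subrr add0r enormZ r1 mulr1.
    by rewrite ger0_norm// ltW.
  have := dot_le_enorm (a + h *: r - l) r; rewrite r1 mulr1 -/(edist _ l).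
  have -> : dot (z - a) r = h * enorm r ^+ 2 - dot (a + h *: r - l) r - dot (l - z) r.
    by rewrite enorm_sqr !dotE !mxE; ring.
  by have := rz _ Ll; rewrite r1; lra.
have s0 : (1 - x) * 2 <= (1 + x) * enorm (n + m).
  rewrite -(ler_pM2r h0).
  have := dot_le_enorm (z - a) (n + m).
  have -> : dot (z - a) (n + m) = dot (z - a) n + dot (z - a) m.
    by rewrite !dotE !mxE; ring.
  have := key _ n1 nz; have := key _ m1 mz.
  have : edist z a * enorm (n + m) <= (h + d) * enorm (n + m).
    by rewrite ler_wpM2r// enorm_ge0.
  rewrite -/(edist z a) /d; lra.
have sd : enorm (n + m) ^+ 2 = 4 - edist n m ^+ 2.
  have : enorm n ^+ 2 + enorm m ^+ 2 = 2 by rewrite n1 m1; ring.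
  rewrite /edist !enorm_sqr => /(congr1 (fun t => 2 * t)) E.
  by move: E; rewrite !dotE !mxE; lra.
have c2 : c ^+ 2 <= edist n m ^+ 2 by rewrite ler_sqr ?nnegrE ?edist_ge0// ltW.
have : 32 * x <= edist n m ^+ 2 by rewrite /x; lra.
have : 0 <= enorm (n + m) by exact: enorm_ge0.
have x1 : x <= 1 / 8.
  have : enorm (n + m) ^+ 2 >= 0 by exact: sqr_ge0.
  rewrite sd /x; lra.
move: s0 sd; move: (enorm _) (edist _ _) => s q s0 sd sp xq.
have : ((1 - x) * 2) ^+ 2 <= ((1 + x) * s) ^+ 2.
  by rewrite ler_sqr// nnegrE ?mulr_ge0//; lra.
rewrite exprMn (exprMn _ (1 + x)) sd.
have : (1 + x) ^+ 2 * (4 - q ^+ 2) <= (1 + x) ^+ 2 * (4 - 32 * x).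
  by rewrite ler_wpM2l ?sqr_ge0//; lra.
nra.
Qed.

Lemma comeagre_unique_tangents : comeagre [set C : curve R | unique_tangents C].
Proof.
apply: (@meagre_bigcup _ _ setT cornered) => //.
- by move=> k _; exact: nowhere_dense_cornered.
move=> C; apply: contra_notP => nC; apply: uncornered_unique_tangents => k kC.
by apply: nC; exists k.
Qed.

End smoothness.

(** * Peaks: strict local maxima of the distance to a point *)

Section peaks.
Context {R : realType}.
Implicit Types (u v w x y z p m c d : 'rV[R]_2) (K A B : set 'rV[R]_2).
Implicit Types (t e r h k : R).

(** A strict local maximum of the distance to u on K, recorded by the disc of
centre c and radius r.  The points of K on the boundary circle should be beaten;
widening the circle to an annulus of half-width h, and asking for the margin h,
makes the condition stable under perturbation of all the data. *)
Definition peak K u c r h := exists z, [/\ K z, edist z c <= r - h &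
  forall w, K w -> r - h <= edist w c <= r + h -> edist w u + h <= edist z u].

(** Each of the two distances compared changes by at most 2 e, and so does the
distance to the centre: the margin loses 4 e, which is at most h / 2. *)
Lemma peak_perturb K K' u u' c c' r h e : peak K u c r h -> 8 * e <= h ->
  K `<=` thickening e K' -> K' `<=` thickening e K ->
  edist u u' <= e -> edist c c' <= e -> peak K' u' c' r (h / 2).
Proof.
move=> [z [Kz zc zmax]] eh KK' K'K uu' cc'.
have e0 : 0 <= e := le_trans (edist_ge0 _ _) uu'.
have [z' K'z' zz'] := KK' _ Kz; exists z'; split=> //.
  have := edist_triangle z z' c'; have := edist_triangle c z c'.
  rewrite (edistC z' z); lra.
move=> w' K'w' /andP[w1 w2]; have [w Kw ww'] := K'K _ K'w'.
have := zmax _ Kw; have := edist_triangle w w' u'; have := edist_triangle u w u'.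
have := edist_triangle z' z u; have := edist_triangle u' z' u.
have := edist_triangle w' w c; have := edist_triangle c' w' c.
have := edist_triangle w w' c'; have := edist_triangle c w c'.
rewrite (edistC u' u) (edistC c' c) (edistC w w') => h1 h2 h3 h4 h5 h6 h7 h8 h9.
have : edist w u + h <= edist z u by apply: h9; lra.
lra.
Qed.

Lemma edist_ball_compact c r : compact [set v : 'rV[R]_2 | edist v c <= r].
Proof.
have -> : [set v : 'rV[R]_2 | edist v c <= r] = thickening r [set c].
  apply/seteqP; split=> v /=; first by exists c.
  by move=> [_ ->].
exact/thickening_compact/compact_set1.
Qed.

(** The farthest point m from u in the part of K inside the disc is not near the
boundary circle.  So one can move slightly from m towards any w in K without
leaving the disc and without increasing the distance to u, which forces
(w - m) . (m - u) < 0 as soon as w differs from m.  As K has another point, m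
is not u. *)
Lemma peak_summit K u c r h : convex_set K -> compact K -> interior K !=set0 ->
  0 < h -> peak K u c r h -> exists m, [/\ K m, m != u, edist m c <= r - h &
    forall w, K w -> dot (w - m) (m - u) <= 0].
Proof.
move=> /convex_setP vK cK iK h0 [z [Kz zc zmax]].
pose A := K `&` [set v | edist v c <= r].
have [||m [Km mc] mmax] := @farthest_point _ A u.
- by apply: compact_closedI => //; apply: compact_closed_rV; exact: edist_ball_compact.
- by exists z; split=> //=; lra.
have zm : edist z u <= edist m u by apply: mmax; split=> //=; lra.
have mch : edist m c <= r - h.
  rewrite leNgt; apply/negP => mrh; have := zmax _ Km; move: mc => /= mc.
  have -> : r - h <= edist m c <= r + h by apply/andP; split; lra.
  by move=> /(_ isT); lra.
have lt0 w : K w -> w != m -> dot (w - m) (m - u) < 0.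
  move=> Kw wm; have s0 : 0 < edist w m by rewrite edist_gt0.
  (* small enough for m + t (w - m) to be at distance at most h from m *)
  pose t := h / (h + edist w m).
  have t0 : 0 < t by rewrite divr_gt0// addr_gt0.
  have t1 : t <= 1 by rewrite ler_pdivrMr ?addr_gt0//; lra.
  have tE : t * (h + edist w m) = h by rewrite divfK// gt_eqF// addr_gt0.
  have : edist (m + t *: (w - m)) u <= edist m u.
    apply: mmax; split; first exact: vK (ltW t0) t1.
    have := edist_triangle m (m + t *: (w - m)) c => /=.
    have -> : edist (m + t *: (w - m)) m = t * edist w m.
      by rewrite /edist addrAC subrr add0r enormZ ger0_norm// ltW.
    have : 0 <= t * h by rewrite mulr_ge0// ltW.
    lra.
  rewrite edist_le_dot.
  have -> : dot (m + t *: (w - m) - u) (m + t *: (w - m) - u) =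
      dot (m - u) (m - u) + t * (2 * dot (w - m) (m - u) + t * edist w m ^+ 2).
    by rewrite /edist enorm_sqr !dotE !mxE; ring.
  rewrite gerDl pmulr_rle0//.
  have : 0 < t * edist w m ^+ 2 by rewrite mulr_gt0// exprn_gt0.
  lra.
exists m; split=> //.
  case: iK => q /nbhs_edistP[e e0 eK]; apply/eqP => mu.
  have [w Kw wm] : exists2 w, K w & w != m.
    pose q' := q + const_mx (e / 4) : 'rV[R]_2.
    have qq' : edist q q' < e.
      rewrite /edist opprD addrA subrr sub0r enormN (le_lt_trans (enorm_le_norm _))//.
      have : `|const_mx (e / 4) : 'rV[R]_2| <= e / 4.
        rewrite [leLHS]/Num.norm/= mx_normrE.
        apply: bigmax_le => [|[i j] _ /=]; first by rewrite divr_ge0// ltW.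
        by rewrite mxE ger0_norm// divr_ge0// ltW.
      by rewrite -mulr_natl; lra.
    have [qm|] := eqVneq q m; last by exists q => //; apply: eK; rewrite edistxx.
    exists q'; first exact: eK.
    apply/eqP => /rowP/(_ 0); rewrite -qm !mxE; lra.
  by have := lt0 _ Kw wm; rewrite mu subrr dotE !mxE !mulr0 addr0 ltxx.
move=> w Kw; have [->|/(lt0 _ Kw)/ltW//] := eqVneq w m.
by rewrite subrr dotE !mxE !mul0r addr0.
Qed.

(** The distance to u decreases at a rate bounded below in all directions from p
into K, so that p beats every sufficiently small circle around it. *)
Lemma sharp_peak K u p k : K p -> p != u -> 0 < k ->
  (forall w, K w -> dot (w - p) (p - u) <= - k * edist w p) ->
  exists2 e0 : R, 0 < e0 & forall e, 0 < e -> e <= e0 ->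
    exists2 h : R, 0 < h & peak K u p e h.
Proof.
move=> Kp pu k0 pk; have r0 : 0 < edist p u by rewrite edist_gt0.
exists (k / 2); first by rewrite divr_gt0.
move=> e e0 ek.
have D0 : 0 < 4 * edist p u + 2 * k by rewrite addr_gt0// mulr_gt0.
(* the drop is at least k e / (4 |p - u|) on the annulus, and the half-width
   must not exceed e / 2: this h is below both bounds *)
pose h := k * e / (4 * edist p u + 2 * k).
have h0 : 0 < h by rewrite !divr_gt0// mulr_gt0.
have hE : h * (4 * edist p u + 2 * k) = k * e by rewrite divfK// gt_eqF.
have hr : 0 < h * edist p u by rewrite mulr_gt0.
have he : h <= e / 2.
  rewrite -(ler_pM2r k0); lra.
exists h => //; exists p; split=> //; first by rewrite edistxx; lra.
move=> w Kw /andP[w1 w2]; have := pk _ Kw.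
have : edist w u ^+ 2 = edist p u ^+ 2 + 2 * dot (w - p) (p - u) + edist w p ^+ 2.
  by rewrite /edist !enorm_sqr !dotE !mxE; ring.
have := edist_ge0 w u.
move: (dot _ _) (edist w p) (edist w u) (edist p u) r0 D0 hE hr w1 w2 => a s q r.
move=> r0 D0 hE hr w1 w2 q0 qE ak.
have ss : s ^+ 2 <= k * s by rewrite expr2 ler_wpM2r; lra.
have ks : k * e / 2 <= k * s by rewrite -mulrA ler_wpM2l; lra.
have qr : q ^+ 2 <= r ^+ 2 - k * e / 2 by lra.
rewrite leNgt; apply/negP => qh.
have [rq|qlr] := leP r q.
  have : r ^+ 2 <= q ^+ 2 by rewrite ler_sqr// nnegrE// ltW.
  have : 0 < k * e by rewrite mulr_gt0. 
  lra.
have : (r - q) * (r + q) <= h * (2 * r) by apply: ler_pM; lra.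
have : 0 < h * k by rewrite mulr_gt0.
have -> : (r - q) * (r + q) = r ^+ 2 - q ^+ 2 by ring.
lra.
Qed.

(** For convex K, the convex hull of K and p. *)
Definition cone p K : set 'rV[R]_2 :=
  [set x | exists y t, [/\ K y, 0 <= t <= 1 & x = p + t *: (y - p)]].

Lemma cone_apex p K : K !=set0 -> cone p K p.
Proof.
by move=> [y Ky]; exists y, 0; rewrite lexx ler01 scale0r addr0.
Qed.

Lemma sub_cone p K : K `<=` cone p K.
Proof.
by move=> x Kx; exists x, 1; rewrite lexx ler01 scale1r addrC subrK.
Qed.

Lemma cone_sub p K B : convex_set B -> K `<=` B -> B p -> cone p K `<=` B.
Proof.
move=> /convex_setP vB KB Bp x [y [t [/KB By /andP[t0 t1] ->]]]; exact: vB.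
Qed.

Lemma convex_cone p K : convex_set K -> convex_set (cone p K).
Proof.
move=> /convex_setP vK; apply/convex_setP.
move=> x x' s [y [t [Ky /andP[t0 t1] ->]]] [y' [t' [Ky' /andP[t'0 t'1] ->]]] s0 s1.
(* the coefficient of the combination; q = 0 only at the apex *)
pose q := (1 - s) * t + s * t'.
have st : 0 <= (1 - s) * t by rewrite mulr_ge0// subr_ge0.
have st' : 0 <= s * t' by rewrite mulr_ge0.
have q1 : q <= 1 by rewrite /q; nra.
have [q0|q0] := eqVneq q 0.
  exists y, 0; split=> //; first by rewrite lexx ler01.
  have e1 : (1 - s) * t = 0 by rewrite /q in q0; lra.
  have e2 : s * t' = 0 by rewrite /q in q0; lra.
  transitivity (p + ((1 - s) * t) *: (y - p) + (s * t') *: (y' - p)).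
    by apply/rowP => i; rewrite !mxE; ring.
  by rewrite e1 e2 !scale0r !addr0.
have {}q0 : 0 < q by rewrite lt_neqAle eq_sym q0 addr_ge0.
exists (y + (s * t' / q) *: (y' - y)), q; split.
- by apply: vK => //; rewrite ?divr_ge0 ?ler_pdivrMr// ?(ltW q0)// /q; lra.
- by rewrite q1 ltW.
- by apply/rowP => i; rewrite !mxE /q; field; rewrite -/q gt_eqF.
Qed.

Lemma compact_cone p K : compact K -> compact (cone p K).
Proof.
move=> cK.
have -> : cone p K = (fun q : 'rV[R]_2 * R => p + q.2 *: (q.1 - p)) @`
    (K `*` `[0, 1]%classic).
  apply/seteqP; split=> [x [y [t [Ky t01 ->]]]|_ [[y t] [/= Ky t01] <-]].
    by exists (y, t) => //; split=> //=; rewrite in_itv.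
  by exists y, t; move: t01; rewrite in_itv.
apply: continuous_compact; last by apply: compact_setX => //; exact: segment_compact.
apply: continuous_subspaceT => q; apply: cvgD; first exact: cvg_cst.
apply: cvgZ; first exact: cvg_snd.
by apply: cvgB; [exact: cvg_fst|exact: cvg_cst].
Qed.

(** Sharpness of a peak at p is inherited by convex hulls: it is a sublevel
condition on a convex function of w. *)
Lemma convex_sharp u p k : 0 <= k ->
  convex_set [set w | dot (w - p) (p - u) <= - k * edist w p].
Proof.
move=> k0; apply/convex_setP => x y t /= xk yk t0 t1.
have -> : dot (x + t *: (y - x) - p) (p - u) =
    (1 - t) * dot (x - p) (p - u) + t * dot (y - p) (p - u).
  by rewrite !dotE !mxE; ring.
have : edist (x + t *: (y - x)) p <= (1 - t) * edist x p + t * edist y p.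
  rewrite /edist (_ : _ - p = (1 - t) *: (x - p) + t *: (y - p)).
    rewrite (le_trans (enormD _ _))// !enormZ !ger0_norm ?subr_ge0//.
  by apply/rowP => i; rewrite !mxE; ring.
move=> /(ler_wpM2l k0).
have : (1 - t) * dot (x - p) (p - u) <= (1 - t) * (- k * edist x p).
  by rewrite ler_wpM2l// subr_ge0.
have : t * dot (y - p) (p - u) <= t * (- k * edist y p) by rewrite ler_wpM2l.
lra.
Qed.

Definition perp d : 'rV[R]_2 := \row_j (if j == 0 then - d 0 1 else d 0 0).

Lemma perp0 d : perp d 0 0 = - d 0 1. Proof. by rewrite mxE. Qed.
Lemma perp1 d : perp d 0 1 = d 0 0. Proof. by rewrite mxE. Qed.

Lemma dot_perp d : dot d (perp d) = 0.
Proof. by rewrite dotE perp0 perp1; ring. Qed.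

Lemma enorm_perp d : enorm (perp d) = enorm d.
Proof. by rewrite /enorm !dotE perp0 perp1; congr Num.sqrt; ring. Qed.

End peaks.

(** * Doubling a peak by a small perturbation *)

Section two_peaks.
Context {R : realType}.
Implicit Types (u v w x y z p m c d : 'rV[R]_2) (K A B : set 'rV[R]_2).
Implicit Types (t e r h k : R).

(** Put d = m - u.  The new points are m + s d +- t (perp d): they stick out of
the supporting line at m by s |d|, and their distance to each other is 2 t |d|.
With t (2 D + |d|) = s |d|, where D bounds the diameter of K, the sideways
displacement is so small that the distance to u decreases along all segments
from them to points of K. *)
Lemma two_sharp_peaks K u m e : convex_set K -> compact K -> K m -> m != u ->
  (forall w, K w -> dot (w - m) (m - u) <= 0) -> 0 < e ->
  exists K' (p : bool -> 'rV[R]_2) k,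
    [/\ convex_set K', compact K', K `<=` K', K' `<=` thickening e K &
        [/\ p false != p true, forall b, edist (p b) m <= e, 0 < k &
        forall b, [/\ K' (p b), p b != u &
          forall w, K' w -> dot (w - p b) (p b - u) <= - k * edist w (p b)]]].
Proof.
move=> vK cK Km mu msup e0.
have [D D0 DK] := compact_edist_bounded cK.
pose d := m - u; pose l := enorm d.
have l0 : 0 < l by rewrite -/(edist m u) edist_gt0.
pose s := e / (2 * l); have s0 : 0 < s by rewrite divr_gt0// mulr_gt0.
have sl : s * l = e / 2 by rewrite /s; field; rewrite gt_eqF.
have Dl0 : 0 < 2 * D + l by rewrite addr_gt0// mulr_gt0.
pose t := s * l / (2 * D + l).
have t0 : 0 < t by rewrite divr_gt0// mulr_gt0.
have tE : t * (2 * D + l) = s * l by rewrite divfK// gt_eqF.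
have tl0 : 0 < t * l by rewrite mulr_gt0.
have tD0 : 0 < t * D by rewrite mulr_gt0.
(* the sign of the sideways displacement *)
pose sg b : R := if b then 1 else -1.
have sg2 b : sg b * sg b = 1 by rewrite /sg; case: b; ring.
have sgN b : sg (~~ b) = - sg b by rewrite /sg; case: b; ring.
have nsg b : `|sg b| = 1 by rewrite /sg; case: b; rewrite ?normrN1 ?normr1.
pose p b := m + s *: d + (sg b * t) *: perp d.
have pm b : edist (p b) m <= e.
  have -> : edist (p b) m = enorm (s *: d + (sg b * t) *: perp d).
    by congr enorm; apply/rowP => i; rewrite /p !mxE; ring.
  rewrite (le_trans (enormD _ _))//.
  rewrite !enormZ enorm_perp [`|sg b * t|]normrM nsg mul1r !gtr0_norm// -/l.
  have : t * l <= s * l by rewrite -tE; lra.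
  lra.
have pu b : dot (p b - u) d = (1 + s) * l ^+ 2.
  rewrite /l enorm_sqr; transitivity ((1 + s) * dot d d + sg b * t * dot d (perp d)).
    by rewrite /p /d !dotE !mxE; ring.
  by rewrite dot_perp; ring.
have pneq b : p b != u.
  apply/eqP => pbu; have := pu b; rewrite pbu subrr dotE !mxE !mul0r addr0.
  by move/esym/eqP; rewrite mulf_eq0 sqrf_eq0 !gt_eqF// addr_gt0.
(* the slope from a peak towards K, where D + e bounds the distances; the slope
   towards the other peak is t l *)
pose k0 := s * l ^+ 2 / 2 / (D + e).
have De0 : 0 < D + e by rewrite addr_gt0.
have k00 : 0 < k0 by rewrite !divr_gt0// mulr_gt0// exprn_gt0.
have k0E : k0 * (D + e) = s * l ^+ 2 / 2 by rewrite divfK// gt_eqF.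
pose k := Num.min k0 (t * l).
have k_gt0 : 0 < k by rewrite lt_min k00.
have peakK b w : K w -> dot (w - p b) (p b - u) <= - k * edist w (p b).
  move=> Kw; have wm := DK _ _ Kw Km.
  have wp : edist w (p b) <= D + e.
    by have := edist_triangle m w (p b); have := pm b; rewrite (edistC m); lra.
  have cs : sg b * dot (w - m) (perp d) <= D * l.
    have -> : sg b * dot (w - m) (perp d) = dot (w - m) (sg b *: perp d).
      by rewrite !dotE !mxE; ring.
    rewrite (le_trans (dot_le_enorm _ _))// enormZ nsg mul1r enorm_perp -/l.
    by rewrite ler_wpM2r// ltW.
  have := ler_wpM2l (ltW t0) cs => {}cs.
  have kk : k * edist w (p b) <= k0 * (D + e).
    by apply: ler_pM; rewrite ?edist_ge0 ?(ltW k_gt0)// ge_min lexx.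
  have E : dot (w - p b) (p b - u) = (1 + s) * dot (w - m) d - s * (1 + s) * l ^+ 2
      + t * (sg b * dot (w - m) (perp d)) - (sg b * sg b) * t ^+ 2 * l ^+ 2.
    transitivity ((1 + s) * dot (w - m) d - s * (1 + s) * dot d d
      + t * (sg b * dot (w - m) (perp d)) - (sg b * sg b) * t ^+ 2 * dot (perp d) (perp d)
      - (1 + s + s) * (sg b * t) * dot d (perp d)).
      by rewrite /p /d !dotE !mxE /=; ring.
    by rewrite dot_perp mulr0 subr0 -!enorm_sqr enorm_perp.
  have t1 : 0 <= (sg b * sg b) * t ^+ 2 * l ^+ 2.
    by rewrite sg2 mul1r mulr_ge0// sqr_ge0.
  have t2 : (1 + s) * dot (w - m) d <= 0.
    by rewrite pmulr_rle0 ?addr_gt0//; exact: msup.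
  have t3 : 0 <= s ^+ 2 * l ^+ 2 by rewrite mulr_ge0// sqr_ge0.
  have t4 : t * (D * l) <= s * l ^+ 2 / 2.
    have : t * D * l <= s * l / 2 * l by apply: ler_wpM2r; [exact: ltW|lra].
    lra.
  lra.
have peakp b : dot (p (~~ b) - p b) (p b - u) <= - k * edist (p (~~ b)) (p b).
  have -> : p (~~ b) - p b = (- 2 * sg b * t) *: perp d.
    by apply/rowP => i; rewrite /p sgN !mxE; ring.
  have -> : edist (p (~~ b)) (p b) = 2 * t * l.
    rewrite /edist (_ : p (~~ b) - p b = (- 2 * sg b * t) *: perp d).
      by rewrite enormZ enorm_perp (normrM (- 2 * sg b)) (normrM (- 2)) nsg normrN
        mulr1 (gtr0_norm t0) ger0_norm.
    by apply/rowP => i; rewrite /p sgN !mxE; ring.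
  have -> : dot ((- 2 * sg b * t) *: perp d) (p b - u) = - 2 * (t * l) * (t * l).
    transitivity (- 2 * sg b * t * ((1 + s) * dot d (perp d)) -
       2 * (sg b * sg b) * t ^+ 2 * dot (perp d) (perp d)).
      by rewrite /p /d !dotE !mxE; ring.
    by rewrite dot_perp sg2 -enorm_sqr enorm_perp -/l; ring.
  have : k * (t * l) <= t * l * (t * l).
    by rewrite ler_wpM2r// ?(ltW tl0)// ge_min lexx orbT.
  lra.
have K0 : K !=set0 by exists m.
have K10 : cone (p false) K !=set0 by exists (p false); exact: cone_apex.
exists (cone (p true) (cone (p false) K)), p, k; split.
- exact/convex_cone/convex_cone.
- by apply: compact_cone; exact: compact_cone.
- exact: subset_trans (@sub_cone _ _ _) (@sub_cone _ _ _).
- have vT : convex_set (thickening e K) by exact: thickening_convex.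
  have pT b : thickening e K (p b) by exists m.
  by do 2!apply: cone_sub => //; exact: thickening_self (ltW e0).
split=> //.
- apply/eqP => pp; have t20 : 0 < 2 * t by exact: mulr_gt0.
  have /rowP pp0 : (2 * t) *: perp d = 0.
    have -> : (2 * t) *: perp d = p true - p false.
      by apply/rowP => i; rewrite /p /sg !mxE; ring.
    by rewrite pp subrr.
  have : enorm ((2 * t) *: perp d) = 0.
    by rewrite (_ : _ *: _ = 0) ?enorm0//; apply/rowP.
  rewrite enormZ enorm_perp -/l (gtr0_norm t20) -mulrA => tl.
  by have := mulr_gt0 (ltr0Sn R 1) tl0; rewrite tl ltxx.
- move=> b; split=> //.
    by case: b; [exact: cone_apex|apply: sub_cone; exact: cone_apex].
  have vS := @convex_sharp R u (p b) k (ltW k_gt0).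
  have pS b' : dot (p b' - p b) (p b - u) <= - k * edist (p b') (p b).
    have [->|bb'] := eqVneq b' b.
      by rewrite edistxx subrr dotE !mxE !mul0r addr0 mulr0.
    by have -> : b' = ~~ b by case: (b) (b') bb' => -[].
  by apply: (cone_sub vS (cone_sub vS _ (pS _)) (pS _)) => w; exact: peakK.
Qed.

(** Discs with rational data are coded by the two coordinates of the centre and
the radius. *)
Definition rat_center (j : rat * rat * rat) : 'rV[R]_2 :=
  \row_i (if i == 0 then ratr j.1.1 else ratr j.1.2).

Definition rat_radius (j : rat * rat * rat) : R := ratr j.2.

Lemma rat_center_dense p e : 0 < e ->
  exists ab, forall r : rat, edist (rat_center (ab, r)) p < e.
Proof.
move=> e0.
have near (x : R) : exists q : rat, `|ratr q - x| < e / 4.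
  have [|q] := @rat_in_itvoo R (x - e / 4) (x + e / 4); first by lra.
  rewrite in_itv/= => /andP[? ?]; exists q; rewrite ltr_norml; apply/andP; split; lra.
have [a xa] := near (p 0 0); have [b xb] := near (p 0 1).
exists (a, b) => r.
rewrite /edist (le_lt_trans (enorm_le_norm _))//.
have : `|rat_center (a, b, r) - p| <= e / 4.
  rewrite [leLHS]/Num.norm/= mx_normrE.
  apply: bigmax_le => [|[i j] _ /=]; first by rewrite divr_ge0// ltW.
  rewrite (ord1 i) !mxE; case: eqVneq => [->|j0]; first exact: ltW.
  rewrite (_ : j = 1) ?ltW//; apply/val_inj => /=.
  by case: j j0 => -[|[|//]].
by rewrite -mulr_natl; lra.
Qed.

Definition peaked j : set (curve R * 'rV[R]_2) :=
  [set Cu : curve R * 'rV[R]_2 | exists2 h : R, 0 < h &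
    peak (chords Cu.1) Cu.2 (rat_center j) (rat_radius j) h].

Lemma open_peaked j : open (peaked j).
Proof.
rewrite openE => -[C u] [h h0 /= Ch].
have e0 : 0 < h / 8 by rewrite divr_gt0.
exists (ball C (h / 8), [set v | edist u v < h / 8]).
  split; first exact: nbhsx_ballx.
  by apply/nbhs_edistP; exists (h / 8).
move=> [C' u'] [/= ]; rewrite curve_ball => /hausdorff_lt_chords[CC' C'C] uu'.
exists (h / 2); first by rewrite divr_gt0.
apply: peak_perturb Ch _ CC' C'C (ltW uu') _; first by lra.
by rewrite edistxx ltW.
Qed.

Definition disjoint_subdiscs (i : rat * rat * rat) :
  set ((rat * rat * rat) * (rat * rat * rat)) :=
  [set jk | [/\ edist (rat_center jk.1) (rat_center i) + rat_radius jk.1 <= rat_radius i,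
    edist (rat_center jk.2) (rat_center i) + rat_radius jk.2 <= rat_radius i &
    rat_radius jk.1 + rat_radius jk.2 < edist (rat_center jk.1) (rat_center jk.2)]].

Definition forked i : set (curve R * 'rV[R]_2) :=
  \bigcup_(jk in disjoint_subdiscs i) (peaked jk.1 `&` peaked jk.2).

Lemma open_forked i : open (forked i).
Proof. by apply: bigcup_open => jk _; apply: openI; exact: open_peaked. Qed.

(** Double the summit of the peak, and record each of the two new peaks in a small
rational disc centred near it. *)
Lemma peaked_closure_forked i : peaked i `<=` closure (forked i).
Proof.
move=> [C u] [h h0 /= Ch] U [[U1 U2] [/= /nbhs_ballP[e /= e0 eU1] uU2] UU].
have [vC cC iC _] := curve_chords C.
have [m [Km mu mi msup]] := peak_summit vC cC iC h0 Ch.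
pose d := Num.min (e / 8) (h / 4).
have d0 : 0 < d by rewrite lt_min !divr_gt0.
have de : d <= e / 8 by rewrite ge_min lexx.
have dh : d <= h / 4 by rewrite ge_min lexx orbT.
have [K [p [k [vK cK CK KC [pp pm k0 pk]]]]] := two_sharp_peaks vC cC Km mu msup d0.
have [C' C'E CC'] := nearby_curve vK cK d0 CK KC.
have [e1 e10 pe1] := let: And3 a b c := pk false in sharp_peak a b k0 c.
have [e2 e20 pe2] := let: And3 a b c := pk true in sharp_peak a b k0 c.
have dp0 : 0 < edist (p false) (p true) by rewrite edist_gt0.
(* small enough for sharp_peak at both points, and for both discs to remain in
   the given disc and disjoint *)
pose E := Num.min (Num.min e1 e2) (Num.min (h / 4) (edist (p false) (p true) / 4)).
have E0 : 0 < E by rewrite !lt_min e10 e20 !divr_gt0.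
have [r] := rat_in_itvoo E0; rewrite in_itv/= => /andP[r0 rE].
have /and4P[re1 re2 rh rp] : [&& (ratr r : R) <= e1, ratr r <= e2, ratr r <= h / 4 &
    ratr r <= edist (p false) (p true) / 4].
  by move: (ltW rE); rewrite !le_min -!andbA.
have pe : forall b, exists2 h' : R, 0 < h' & peak K u (p b) (ratr r) h'.
  by case; [exact: pe2|exact: pe1].
have /choice[c cP] : forall b, exists ab : rat * rat,
    (exists2 h' : R, 0 < h' & peak K u (rat_center (ab, r)) (ratr r) h') /\
    edist (rat_center (ab, r)) (p b) < ratr r / 4.
  move=> b; have [h' h'0 hp] := pe b.
  (* h' / 8 is the perturbation that peak_perturb tolerates *)
  pose a := Num.min (ratr r / 4) (h' / 8).
  have a0 : 0 < a by rewrite lt_min (divr_gt0 r0) ?(divr_gt0 h'0).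
  have [ab abP] := rat_center_dense (p b) a0; exists ab.
  have := abP r; rewrite lt_min => /andP[ab1 ab2]; split=> //.
  exists (h' / 2); first by rewrite divr_gt0.
  apply: (@peak_perturb _ _ _ _ _ _ _ _ _ (h' / 8) hp _ (thickening_self _)
    (thickening_self _)).
  - by lra.
  - by rewrite divr_ge0// ltW.
  - by rewrite divr_ge0// ltW.
  - by rewrite edistxx divr_ge0// ltW.
  - by rewrite edistC ltW.
have [q1 c1] := cP false; have [q2 c2] := cP true.
exists (C', u); split; last first.
  apply: UU; split; last exact: nbhs_singleton uU2.
  by apply: eU1; rewrite curve_ball; lra.
exists ((c false, r), (c true, r)); last by split; rewrite /peaked/= C'E.
rewrite /disjoint_subdiscs/= /rat_radius/=.
have := edist_triangle (p false) (rat_center (c false, r)) (rat_center i).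
have := edist_triangle (p true) (rat_center (c true, r)) (rat_center i).
have := edist_triangle m (p false) (rat_center i).
have := edist_triangle m (p true) (rat_center i).
have := edist_triangle (rat_center (c false, r)) (p false) (p true).
have := edist_triangle (rat_center (c true, r)) (rat_center (c false, r)) (p true).
have := pm false; have := pm true.
move: mi; rewrite /rat_radius (edistC (p false) (rat_center (c false, r))).
by move=> *; split; lra.
Qed.

Lemma nowhere_dense_unforked i : nowhere_dense (peaked i `\` forked i).
Proof.
apply: (@nowhere_denseS _ _ (closure (forked i) `\` forked i)).
  by move=> x [/peaked_closure_forked].
exact/nowhere_dense_boundary/open_forked.
Qed.

End two_peaks.

(** * From forking peaks to self-images *)

Section images.
Context {R : realType}.
Implicit Types (u v w x y z p m n : 'rV[R]_2) (K A B : set 'rV[R]_2).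
Implicit Types (t e r h k : R).

Lemma plane_second_countable : @second_countable 'rV[R]_2.
Proof.
pose D (j : rat * rat * rat) := [set v : 'rV[R]_2 | edist (rat_center j) v < rat_radius j].
exists (range D); first by apply: sub_countable (card_image_le D setT) _.
split=> [_ [j _ <-]|x U /nbhs_edistP[e e0 eU]].
  rewrite openE => v /= vj; apply/nbhs_edistP.
  exists (rat_radius j - edist (rat_center j) v); first by rewrite subr_gt0.
  by move=> w vw; rewrite /D/=; have := edist_triangle v (rat_center j) w; lra.
have [|r] := @rat_in_itvoo R (e / 4) (e / 2); first by lra.
rewrite in_itv/= => /andP[er re].
have r0 : 0 < ratr r :> R by lra.
have [ab abx] := rat_center_dense x r0.
exists (D (ab, r)); first by split; [exists (ab, r)|exact: abx].
move=> v /= vr; apply: eU; have := edist_triangle (rat_center (ab, r)) x v.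
by have := abx r; rewrite (edistC x (rat_center _)); move: vr; rewrite /D/= /rat_radius/=; lra.
Qed.

(** The points of C at which u - m is an inner normal of C, or 0.  Contrary to the
set of all self-images, this set is visibly closed. *)
Definition inward_normal_feet (C : curve R) u : set 'rV[R]_2 :=
  [set m | curve_set C m /\ forall w, chords C w -> 0 <= dot (w - m) (u - m)].

Lemma closed_inward_normal_feet (C : curve R) u : closed (inward_normal_feet C u).
Proof.
have -> : inward_normal_feet C u = curve_set C `&`
    \bigcap_(w in chords C) [set m | 0 <= dot (w - m) (u - m)].
  by apply/seteqP; split=> m [Cm mw]; split.
apply: closedI; first exact: curve_closed.
apply: closed_bigI => w _.
apply: (@closed_dot_ge _ _ (fun m => w - m) (fun m => u - m)) => m;
  exact: cvgB (cvg_cst _) cvg_id.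
Qed.

(** If u = z, which is allowed, any supporting line at z serves as tangent. *)
Lemma inward_normal_feet_self_images (C : curve R) u :
  inward_normal_feet C u `<=` self_images C u.
Proof.
move=> z [Cz zu]; split=> //; have [vC cC _ Cf] := curve_chords C.
have [n [n0 [Cn [t [t0 ut]]]]] : exists n, n != 0 /\
    (forall w, chords C w -> dot (w - z) n <= 0) /\
    exists t, 0 <= t /\ u - z = - t *: n.
  have [->|zneu] := eqVneq u z.
    have [|n n1 nz] := supporting_normal vC cC (z := z); first by rewrite -Cf.
    exists n; split; first by rewrite -enorm_gt0 n1.
    by split=> //; exists 0; rewrite subrr oppr0 scale0r.
  exists (z - u); split; first by rewrite subr_eq0 eq_sym.
  split; last by exists 1; rewrite scaleN1r opprB.
  by move=> w /zu; rewrite -(opprB u z) dotNr oppr_le0.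
have perp_neq0 : perp n != 0 by rewrite -enorm_gt0 enorm_perp enorm_gt0.
exists (line z n), (line z (perp n)); split.
- by apply: line_tangent => // w /chords_self/Cn.
- split; first by exists z, (perp n).
    by rewrite /line/= subrr dotE !mxE !mul0r addr0.
  move=> x y a b; rewrite /line/= => xn yn an bn.
  have xyn : dot (x - y) n = 0 by rewrite -[RHS]subr0 -{1}xn -yn !dotE !mxE; ring.
  have abn : dot (a - b) (perp n) = 0.
    by rewrite -[RHS]subr0 -{1}an -bn !dotE !mxE; ring.
  (* expansion in the orthogonal basis n, perp n *)
  have : dot n n * dot (x - y) (a - b) = 0.
    transitivity (dot (x - y) n * dot (a - b) n +
        dot (x - y) (perp n) * dot (a - b) (perp n)).
      by rewrite !dotE perp0 perp1; ring.
    by rewrite xyn abn mul0r mulr0 addr0.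
  by move/eqP; rewrite mulf_eq0 dotuu_eq0 (negbTE n0) => /eqP.
- by rewrite /line/= ut dotZl dot_perp mulr0.
- exists z, (- n); split; first by rewrite oppr_eq0.
    apply/seteqP; split=> x; rewrite /line/= dotNr; first by move=> ->; rewrite oppr0.
    by move/eqP; rewrite oppr_eq0 => /eqP.
  move=> w [/chords_self/Cn|->]; rewrite /half_plane/= dotNr oppr_ge0//.
  by rewrite ut dotZl mulNr oppr_le0 mulr_ge0// dotuu_ge0.
Qed.

(** The summit of a peak is on the boundary: moving away from u from an interior
point would increase the distance. *)
Lemma peak_inward_normal (C : curve R) u c r h : 0 < h -> peak (chords C) u c r h ->
  exists2 m, inward_normal_feet C u m & edist m c <= r.
Proof.
move=> h0 Ch; have [vC cC iC Cf] := curve_chords C.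
have [m [Km mu mc msup]] := peak_summit vC cC iC h0 Ch.
exists m; last by lra.
split; last first.
  by move=> w /msup; rewrite -(opprB u m) dotNr oppr_le0.
rewrite Cf frontierE; last exact: compact_closed_rV.
split=> // /nbhs_edistP[e e0 eK].
have d0 : 0 < edist m u by rewrite edist_gt0.
pose t := e / (2 * edist m u).
have t0 : 0 < t by rewrite divr_gt0// mulr_gt0.
have : dot (t *: (m - u)) (m - u) <= 0.
  have -> : t *: (m - u) = m + t *: (m - u) - m by rewrite addrAC subrr add0r.
  apply/msup/eK; rewrite /edist opprD addrA subrr sub0r enormN enormZ gtr0_norm//.
  by rewrite -/(edist m u) (_ : t * _ = e / 2); [lra|rewrite /t; field; rewrite gt_eqF].
by rewrite dotZl pmulr_rle0// -enorm_sqr leNgt exprn_gt0.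
Qed.

(** A disc that contains the whole body in its interior has a vacuous boundary
condition. *)
Lemma exists_peaked (C : curve R) u : exists j, peaked j (C, u).
Proof.
have [vC cC [q iq] Cf] := curve_chords C; have Kq := interior_subset iq.
have [M MC] : exists M, forall w, chords C w -> edist w (rat_center (0, 0, 0)) <= M.
  have [D D0 DK] := compact_edist_bounded cC.
  exists (D + edist q (rat_center (0, 0, 0))) => w Kw.
  by have := edist_triangle q w (rat_center (0, 0, 0)); have := DK _ _ Kw Kq; lra.
have [|r] := @rat_in_itvoo R (M + 2) (M + 3); first by lra.
rewrite in_itv/= => /andP[rM _].
have c0 : rat_center (0, 0, r) = rat_center (0, 0, 0) :> 'rV[R]_2 by [].
exists (0, 0, r); exists 1 => //; exists q; rewrite /rat_radius/= c0.
split=> //; first by have := MC _ Kq; lra.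
by move=> w /MC wM /andP[rw _]; lra.
Qed.

(** The Cantor scheme of the discs with a peak, cut down to the feet of inward
normals: a disc with a peak contains such a foot. *)
Lemma continuum_self_images (C : curve R) u :
  (forall i, peaked i (C, u) -> forked i (C, u)) ->
  (self_images C u #= [set: R])%card.
Proof.
move=> Cu; have [j0 j0P] := exists_peaked C u.
pose A j := inward_normal_feet C u `&` [set v | edist v (rat_center j) <= rat_radius j].
have : ([set: nat -> bool] #<= A j0)%card.
  apply: (@cantor_scheme _ _ [set j | peaked j (C, u)] A) => //.
  - move=> j [h h0 /= jh]; split.
      rewrite /A setIC; apply: compact_closedI; first exact: edist_ball_compact.
      exact: closed_inward_normal_feet.
    by have [m mi mc] := peak_inward_normal h0 jh; exists m.
  - move=> i /Cu[[j k] [/= ji ki jk] [Pj Pk]]; exists j, k; split=> //.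
    + move=> v [? /= vj]; split=> //=.
      by have := edist_triangle (rat_center j) v (rat_center i); lra.
    + move=> v [? /= vj]; split=> //=.
      by have := edist_triangle (rat_center k) v (rat_center i); lra.
    + rewrite -subset0 => v [[_ /= vj] [_ /= vk]].
      by have := edist_triangle v (rat_center j) (rat_center k); rewrite (edistC _ v); lra.
move=> bA; apply: continuum_of_bool_seq; apply: card_le_trans bA _.
by apply: subset_card_le => v [/inward_normal_feet_self_images].
Qed.

End images.

Theorem theorem1p1 (R : realType) :
  exists2 S : set (curve R), comeagre S &
    forall C : curve R, S C ->
      unique_tangents C /\
      comeagre [set u : 'rV[R]_2 | (self_images C u #= [set: R])%card].
Proof.
pose E := [set Cu : curve R * 'rV[R]_2 | (self_images Cu.1 Cu.2 #= [set: R])%card].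
have cE : comeagre E.
  apply: (@meagre_bigcup _ _ setT (fun i => peaked i `\` forked i)) => //.
    by move=> i _; exact: nowhere_dense_unforked.
  move=> [C u]; apply: contra_notP => nCu; apply: continuum_self_images => i iP.
  by apply: contrapT => niF; apply: nCu; exists i.
exists ([set C : curve R | unique_tangents C] `&`
        [set C : curve R | comeagre [set u | E (C, u)]]); last by move=> C [].
rewrite /comeagre setCI; apply: meagreU; first exact: comeagre_unique_tangents.
exact: comeagre_sections plane_second_countable cE.
Qed.
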